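(* Let $X$ be a countable set and $m : X\to(0,\infty)$ a measure. Let $E$ be the edge set of a connected combinatorial graph over $X$, and let the operator $L\ge 0$ on $\ell^2(X,m)$ be a Laplacian based on the graph with edge set $E$, with $C_c(X)\subset D(L^n)$ for all natural numbers $n$. Then, for all $x,y\in X$, $$\lim_{t\to 0+}\frac{\log|\langle 1_x,e^{-tL}1_y\rangle|}{\log t}=d_E(x,y)=\lim_{t\to 0+}\frac{\log|\langle 1_x,e^{-itL}1_y\rangle|}{\log t}.$$
   Context: $\ell^2(X,m)$ is the complex Hilbert space of functions $f:X\to\mathbb{C}$ with $\sum_{x\in X}|f(x)|^2m(x)<\infty$, with its natural inner product $\langle\cdot,\cdot\rangle$ weighted by $m$. $C_c(X)$ is the set of functions on $X$ with finite support, and $1_x$ is the characteristic function of $\{x\}$. A combinatorial graph over $X$ is given by a set $E\subseteq X\times X$ (the edge set) such that $(x,y)\in E$ implies $(y,x)\in E$, and $(x,x)\notin E$ for all $x\in X$. A sequence $(x_1,\dots,x_n)$ in $X$ with $(x_j,x_{j+1})\in E$ for $j=1,\dots,n-1$ is a path from $x_1$ to $x_n$; its length is the number $n-1$ of its edges. The graph is connected if there is a path between any two points of $X$. In this case $d_E(x,y)$ is the smallest length of a path connecting $x$ and $y$ if $x\ne y$, and $d_E(x,x)=0$. A selfadjoint operator $L\ge 0$ on $\ell^2(X,m)$ with $C_c(X)\subseteq D(L^{1/2})$ is a Laplacian based on a graph with edge set $E$ if for any $x,y\in X$ with $x\neq y$ one has $\langle 1_x,L1_y\rangle:=\langle L^{1/2}1_x,L^{1/2}1_y\rangle\le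 0$, with strict inequality if and only if $(x,y)\in E$. $D(A)$ denotes the domain of an operator $A$. The operators $L^n$, $L^{1/2}$, $e^{-tL}$, $e^{-itL}$ are defined by the spectral calculus. *)

(* Defs.v *)
From HB Require Import structures.
From mathcomp Require Import all_boot all_order all_algebra.
From mathcomp Require Import all_classical all_reals all_analysis.
From mathcomp Require Export complex.

Set Implicit Arguments.
Unset Strict Implicit.
Unset Printing Implicit Defensive.

Import Order.TTheory GRing.Theory Num.Theory.
Import numFieldNormedType.Exports.

Local Open Scope classical_set_scope.
Local Open Scope ring_scope.
Local Open Scope complex_scope.

Definition cmod (R : realType) (z : R[i]) : R := ComplexField.Normc.normc z.

(** * The Hilbert space l^2(X, m) *)

(* Unordered sums of absolutely summable families; [esum] only handles
   nonnegative families. *)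
Definition rsum (R : realType) (X : choiceType) (f : X -> R) : R :=
  fine (\esum_(x in [set: X]) ((f^\+)%R x)%:E)
  - fine (\esum_(x in [set: X]) ((f^\-)%R x)%:E).

Definition csum (R : realType) (X : choiceType) (f : X -> R[i]) : R[i] :=
  rsum (fun x => complex.Re (f x)) +i* rsum (fun x => complex.Im (f x)).

Section HilbertSpace.
Context (R : realType) (X : countType) (m : X -> R).

Definition l2 : set (X -> R[i]) :=
  [set f | (\esum_(x in [set: X]) (cmod (f x) ^+ 2 * m x)%:E < +oo)%E].

(* Linear in the second argument. *)
Definition inner (f g : X -> R[i]) : R[i] :=
  csum (fun x => (f x)^* * g x * (m x)%:C).

Definition l2norm (f : X -> R[i]) : R := Num.sqrt (complex.Re (inner f f)).

Definition Cc : set (X -> R[i]) := [set f | finite_set [set x | f x != 0]].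

Definition delta (x : X) : X -> R[i] := fun y => (y == x)%:R.

(** * Unbounded operators *)

(* The values of [opfun] outside of [opdom] are irrelevant. *)
Record operator := Operator {
  opdom : set (X -> R[i]);
  opfun :> (X -> R[i]) -> X -> R[i] }.

Definition linear_operator (A : operator) : Prop :=
  [/\ opdom A `<=` l2,
      forall f, opdom A f -> l2 (A f),
      opdom A (fun=> 0),
      forall (a : R[i]) f g, opdom A f -> opdom A g ->
        opdom A (fun x => a * f x + g x)
    & forall (a : R[i]) f g, opdom A f -> opdom A g ->
        A (fun x => a * f x + g x) = (fun x => a * A f x + A g x)].

Definition densely_defined (A : operator) : Prop :=
  forall f, l2 f -> forall e : R, 0 < e ->
    exists2 g, opdom A g & l2norm (fun x => f x - g x) < e.

(* [adjoint_graph A g h]: g is in the domain of the adjoint of A, which maps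
   g to h. *)
Definition adjoint_graph (A : operator) (g h : X -> R[i]) : Prop :=
  [/\ l2 g, l2 h & forall f, opdom A f -> inner g (A f) = inner h f].

Definition selfadjoint (A : operator) : Prop :=
  [/\ linear_operator A, densely_defined A
    & forall g h, adjoint_graph A g h <-> opdom A g /\ A g = h].

Definition nonneg_operator (A : operator) : Prop :=
  forall f, opdom A f -> 0 <= inner f (A f).

(** * Spectral calculus *)

Definition orthogonal_projection (Q : (X -> R[i]) -> X -> R[i]) : Prop :=
  [/\ linear_operator (Operator l2 Q),
      forall f, l2 f -> Q (Q f) = Q f
    & forall f g, l2 f -> l2 g -> inner f (Q g) = inner (Q f) g].

Record projection_valued_measure
    (P : set R -> (X -> R[i]) -> X -> R[i]) : Prop := ProjectionValuedMeasure {
  pvm_projection : forall B, measurable B -> orthogonal_projection (P B);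
  pvm0 : forall f, l2 f -> P set0 f = (fun=> 0);
  pvmT : forall f, l2 f -> P [set: R] f = f;
  pvmI : forall A B f, measurable A -> measurable B -> l2 f ->
    P (A `&` B) f = P A (P B f);
  pvm_sigma_additive : forall (B : (set R)^nat) f,
    (forall k, measurable (B k)) -> trivIset [set: nat] B -> l2 f ->
    l2norm (fun x => P (\bigcup_k B k) f x - \sum_(k < n) P (B k) f x)
      @[n --> \oo] --> (0 : R) }.

Context (P : set R -> (X -> R[i]) -> X -> R[i]).

(* The finite Borel measure B |-> <f, P(B) f>. *)
Definition spectral_measure (f : X -> R[i]) : set R -> \bar R :=
  fun B => (complex.Re (inner f (P B f)))%:E.

Definition spectral_integral (f : X -> R[i]) (phi : R -> R[i]) : R[i] :=
  fine (\int[spectral_measure f]_l (complex.Re (phi l))%:E)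
  +i* fine (\int[spectral_measure f]_l (complex.Im (phi l))%:E).

(* The integral of phi against the complex measure B |-> <h, P(B) f>, obtained
   from the positive measures <u, P(.) u> by polarization. *)
Definition spectral_form (phi : R -> R[i]) (h f : X -> R[i]) : R[i] :=
  4^-1 * \sum_(k < 4)
    'i%C ^+ k * spectral_integral (fun x => f x + 'i%C ^+ k * h x) phi.

Definition fcalc_dom (phi : R -> R[i]) : set (X -> R[i]) :=
  [set f | l2 f /\
    (\int[spectral_measure f]_l (cmod (phi l) ^+ 2)%:E < +oo)%E].

(* g = phi(L) f. It suffices to test against the h in D(phi(L)), which is dense;
   for these, spectral_form phi h f is an integral of integrable functions. *)
Definition fcalc_graph (phi : R -> R[i]) (f g : X -> R[i]) : Prop :=
  [/\ fcalc_dom phi f, l2 g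
    & forall h, fcalc_dom phi h -> inner h g = spectral_form phi h f].

(* phi(L) for a Borel function phi, where P is the spectral measure of L. *)
Definition fcalc (phi : R -> R[i]) : operator :=
  Operator (fcalc_dom phi) (fun f => xget (fun=> 0) [set g | fcalc_graph phi f g]).

(* L is the integral of l dP(l), with its natural domain. *)
Definition spectral_resolution (L : operator) : Prop :=
  projection_valued_measure P /\
  forall f g, fcalc_graph (fun l => l%:C) f g <-> opdom L f /\ L f = g.

Definition op_pow (n : nat) : operator := fcalc (fun l => (l ^+ n)%:C).

Definition op_sqrt : operator := fcalc (fun l => (Num.sqrt l)%:C).

(* exp(- t L) *)
Definition heat (t : R) : operator := fcalc (fun l => (expR (- (t * l)))%:C).

(* exp(- i t L) *)
Definition schroedinger (t : R) : operator :=
  fcalc (fun l => cos (t * l) -i* sin (t * l)).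

(** * Graphs and Laplacians *)

(* <1_x, L 1_y>, understood as <L^(1/2) 1_x, L^(1/2) 1_y>. *)
Definition form_coef (x y : X) : R[i] :=
  inner (op_sqrt (delta x)) (op_sqrt (delta y)).

Definition laplacian_on_graph (E : rel X) (L : operator) : Prop :=
  [/\ selfadjoint L, nonneg_operator L, Cc `<=` opdom op_sqrt
    & forall x y, x != y ->
        form_coef x y <= 0 /\ (form_coef x y < 0 <-> E x y)].

End HilbertSpace.

Definition combinatorial_graph (X : countType) (E : rel X) : Prop :=
  symmetric E /\ irreflexive E.

(* There is a path with n edges from x to y. *)
Definition joined_by (X : countType) (E : rel X) (x y : X) (n : nat) : Prop :=
  exists p : seq X, [/\ path E x p, last x p = y & size p = n].

Definition connected_graph (X : countType) (E : rel X) : Prop :=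
  forall x y, exists n, joined_by E x y n.

Definition graph_dist (X : countType) (E : rel X) (x y : X) : nat :=
  if x == y then 0%N else
  xget 0%N [set n | joined_by E x y n /\
                    forall k, joined_by E x y k -> (n <= k)%N].

Arguments operator : clear implicits.

(* Main.v *)
(* Let a_k(x, y) = <1_x, L^k 1_y>. Expanding <L 1_x, L^k 1_y> in coordinates gives
   a_(k+1)(x, y) = sum_z a_1(x, z) a_k(z, y) / m(z), and a_1(x, z) is negative for
   neighbours and zero for the other z distinct from x. By induction a_k(x, y) = 0
   for k < d(x, y), whereas a_k(x, y) has the sign of (-1)^k for k = d(x, y). The
   Taylor expansion of order d = d(x, y) of exp(-tl) or exp(-itl) at t = 0 therefore
   shows that |<1_x, e^(-tL) 1_y>| and |<1_x, e^(-itL) 1_y>| equal |a_d| t^d / d! up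
   to O(t^(d+1)); the remainder is controlled since the spectrum is nonnegative and
   the moments are finite. *)
From HB Require Import structures.
Require Import Defs.
From mathcomp Require Import all_boot all_order all_algebra.
From mathcomp Require Import all_classical all_reals all_analysis.
From mathcomp Require Import measurable_realfun measurable_fun_approximation.
From mathcomp Require Import ring lra.
Import Order.TTheory GRing.Theory Num.Theory.
Import numFieldNormedType.Exports HBSimple HBNNSimple.

Set Implicit Arguments.
Unset Strict Implicit.
Unset Printing Implicit Defensive.

Local Open Scope classical_set_scope.
Local Open Scope complex_scope.
Local Open Scope ring_scope.

(** [fcalc] selects the vector phi(L) f by [xget] from a weak condition, so nothing can be computed
    before such a vector is known to exist. It is built as a limit of step functions of L applied to
    f; these form a Cauchy sequence because |phi(L) f|^2 is the integral of phi^2 against the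
    spectral measure of f. Forms <h, phi(L) f> are kept as combinations of four integrals against
    positive measures, so that dominated convergence and monotonicity apply directly. The
    composition of L with L^k is never formed: <L 1_x, L^k 1_y> is identified with the integral of l
    * l^k by multiplicativity on step functions and a limit. Square roots, the bound on exp(-tl) and
    the Taylor estimate are only usable for l >= 0. That the spectral measures do not charge the
    negative half-line is derived from the nonnegativity of L on vectors. In the recursion for a_k
    the sign condition says nothing about the term z = x; it vanishes because a_k(x, y) = 0 below
    the distance. *)

(** * Modulus of complex numbers and the polarization identity *)

Section Complex.
Context (R : realType).
Implicit Types z w : R[i].

Lemma cmodE z : cmod z = Num.sqrt (complex.Re z ^+ 2 + complex.Im z ^+ 2).
Proof. by case: z. Qed.

Lemma cmod_sq z : cmod z ^+ 2 = complex.Re z ^+ 2 + complex.Im z ^+ 2.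
Proof. by rewrite cmodE sqr_sqrtr // addr_ge0 // sqr_ge0. Qed.

Lemma cmod_ge0 z : 0 <= cmod z.
Proof. by rewrite cmodE sqrtr_ge0. Qed.

Lemma cmodM z w : cmod (z * w) = cmod z * cmod w.
Proof. exact: ComplexField.Normc.normcM. Qed.

Lemma normc_cmod z : `|z| = (cmod z)%:C.
Proof. by []. Qed.

Lemma cmodD z w : cmod (z + w) <= cmod z + cmod w.
Proof. by rewrite -lecR rmorphD /= -!normc_cmod ler_normD. Qed.

Lemma cmod0 : cmod (0 : R[i]) = 0.
Proof. exact: ComplexField.Normc.normc0. Qed.

Lemma cmod0_eq0 z : cmod z = 0 -> z = 0.
Proof. exact: ComplexField.Normc.eq0_normc. Qed.

Lemma cmod_conj z : cmod z^* = cmod z.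
Proof. by rewrite !cmodE; case: z => a b /=; rewrite sqrrN. Qed.

Lemma cmodN z : cmod (- z) = cmod z.
Proof. by rewrite !cmodE; case: z => a b /=; rewrite !sqrrN. Qed.

Lemma cmodr (a : R) : cmod a%:C = `|a|.
Proof. by rewrite cmodE /= expr0n addr0 sqrtr_sqr. Qed.

Lemma cmod_sum (I : Type) (s : seq I) (F : I -> R[i]) :
  cmod (\sum_(i <- s) F i) <= \sum_(i <- s) cmod (F i).
Proof.
elim: s => [|i s IH]; first by rewrite !big_nil cmod0.
by rewrite !big_cons (le_trans (cmodD _ _))// lerD2l.
Qed.

Lemma cmod_iX k : cmod ('i%C ^+ k : R[i]) = 1.
Proof.
elim: k => [|k IH]; first by rewrite expr0 -[1]/(1%:C) cmodr normr1.
by rewrite exprS cmodM IH cmodE /= expr0n expr1n add0r sqrtr1 mulr1.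
Qed.

Lemma cmod_quarter : cmod (4^-1 : R[i]) = 4^-1.
Proof.
rewrite [LHS]ComplexField.Normc.normcV; congr (_^-1).
have -> : (4 : R[i]) = (4 : R)%:C by rewrite [RHS](rmorph_nat (real_complex R) 4).
by rewrite [LHS]cmodr ger0_norm.
Qed.

(* For a sesquilinear form F, take a = F f f, b = F f h, c = F h f, d = F h h. *)
Lemma polarization (a b c d : R[i]) :
  4^-1 * (\sum_(k < 4) 'i%C ^+ k * (a + 'i%C ^+ k * b + ('i%C ^+ k)^* * c +
    ('i%C ^+ k)^* * 'i%C ^+ k * d)) = c :> R[i].
Proof.
rewrite !big_ord_recl big_ord0 /=.
have i2 : 'i%C * 'i%C = -1 :> R[i] by rewrite -expr2 sqr_i.
have E1 : ('i%C : R[i]) ^+ bump 0 0 = 'i%C by [].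
have E2 : ('i%C : R[i]) ^+ bump 0 (bump 0 0) = -1 by rewrite -i2.
have E3 : ('i%C : R[i]) ^+ bump 0 (bump 0 (bump 0 0)) = - 'i%C.
  by rewrite [LHS]exprS -[_ ^+ _]/('i%C * 'i%C) i2 mulrN1.
have ci : ('i%C : R[i])^* = - 'i%C by apply/eqP; rewrite eq_complex /= oppr0 !eqxx.
have cNi : (- 'i%C : R[i])^* = 'i%C by apply/eqP; rewrite eq_complex /= oppr0 opprK !eqxx.
have c1 : (1 : R[i])^* = 1 by apply/eqP; rewrite eq_complex /= oppr0 !eqxx.
have cN1 : (-1 : R[i])^* = -1 by apply/eqP; rewrite eq_complex /= !oppr0 !eqxx.
rewrite E1 E2 E3 expr0 ci cNi c1 cN1.
rewrite [X in _ * X](_ : _ = 2 * b + 2 * c + 2 * ('i%C * 'i%C) * b - 2 * ('i%C * 'i%C) * c); last by ring.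
rewrite i2 [X in _ * X](_ : _ = 4 * c); last by ring.
by rewrite mulKf ?pnatr_eq0.
Qed.

(** Convergence in [R[i]] is expressed by the real modulus of the difference. Identities pass from
    step functions to Borel functions by computing one limit in two ways and applying this
    uniqueness. *)
Lemma cmod_cvg_unique (z : nat -> R[i]) (a b : R[i]) :
  cmod (z n - a) @[n --> \oo] --> (0 : R) ->
  cmod (z n - b) @[n --> \oo] --> (0 : R) -> a = b.
Proof.
move=> za zb; apply/eqP; rewrite -subr_eq0; apply/eqP/cmod0_eq0/eqP.
rewrite eq_le cmod_ge0 andbT.
have H : (cmod (z n - a) + cmod (z n - b)) @[n --> \oo] --> (0 : R).
  by rewrite -[X in _ --> X]addr0; exact: cvgD.
apply: (ler_cvg_to (cvg_cst (cmod (a - b))) H); apply: nearW => n.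
rewrite -(cmodN (z n - a)); apply: le_trans (cmodD _ _).
by rewrite opprB addrA subrK.
Qed.

Lemma Re_le_cmod z : `|complex.Re z| <= cmod z.
Proof. by rewrite cmodE -sqrtr_sqr ler_wsqrtr // lerDl sqr_ge0. Qed.

Lemma Im_le_cmod z : `|complex.Im z| <= cmod z.
Proof. by rewrite cmodE -sqrtr_sqr ler_wsqrtr // lerDr sqr_ge0. Qed.

Lemma conj_real (a : R) : (a%:C)^* = a%:C.
Proof. by apply/eqP; rewrite eq_complex /= oppr0 !eqxx. Qed.

Lemma conj_div_real z (a : R) : (z / a%:C)^* = z^* / a%:C.
Proof. by rewrite rmorphM fmorphV; congr (_ / _); exact: conj_real. Qed.

Lemma cReD z w : complex.Re (z + w) = complex.Re z + complex.Re w.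
Proof. by case: z; case: w. Qed.
Lemma cImD z w : complex.Im (z + w) = complex.Im z + complex.Im w.
Proof. by case: z; case: w. Qed.
Lemma cReB z w : complex.Re (z - w) = complex.Re z - complex.Re w.
Proof. by case: z; case: w. Qed.
Lemma cImB z w : complex.Im (z - w) = complex.Im z - complex.Im w.
Proof. by case: z; case: w. Qed.
Lemma cReM z w : complex.Re (z * w) =
  complex.Re z * complex.Re w - complex.Im z * complex.Im w.
Proof. by case: z; case: w. Qed.
Lemma cImM z w : complex.Im (z * w) =
  complex.Re z * complex.Im w + complex.Im z * complex.Re w.
Proof. by case: z; case: w. Qed.

End Complex.

(** * Unordered sums of real families *)

Section RealSums.
Context (R : realType) (X : choiceType).
Implicit Types f g p q : X -> R.

Definition rsummable f := (\esum_(x in [set: X]) `|f x|%:E < +oo)%E.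

Lemma rsummable_le f g : (forall x, `|f x| <= g x) -> rsummable g -> rsummable f.
Proof.
move=> fg; apply: le_lt_trans; apply: le_esum => x _.
by rewrite lee_fin (le_trans (fg x)) // ler_norm.
Qed.

Lemma rsummableD f g : rsummable f -> rsummable g -> rsummable (f \+ g).
Proof.
move=> sf sg; have := @summableD X R setT (EFin \o f) (EFin \o g) sf sg.
by rewrite /summable /rsummable; apply.
Qed.

Local Notation nsum p := (fine (\esum_(x in [set: X]) (p x)%:E)).

Lemma rsummable_ge0 f : (forall x, 0 <= f x) ->
  rsummable f = (\esum_(x in [set: X]) (f x)%:E < +oo)%E.
Proof.
by move=> f0; rewrite /rsummable; congr (_ < _)%E; apply: eq_esum => x _; rewrite ger0_norm.
Qed.

Lemma rsummable_fin f : (forall x, 0 <= f x) -> rsummable f ->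
  \esum_(x in [set: X]) (f x)%:E = (nsum f)%:E.
Proof.
move=> f0; rewrite rsummable_ge0// => sf; rewrite fineK// ge0_fin_numE//.
by apply: esum_ge0 => x _; rewrite lee_fin.
Qed.

Lemma esumZ (c : R) f : 0 <= c -> (forall x, 0 <= f x) ->
  (\esum_(x in [set: X]) (c * f x)%:E = c%:E * \esum_(x in [set: X]) (f x)%:E)%E.
Proof.
have H a g : 0 <= a -> (forall x, 0 <= g x) ->
  (\esum_(x in [set: X]) (a * g x)%:E <= a%:E * \esum_(x in [set: X]) (g x)%:E)%E.
  move=> a0 g0; apply: ge_ereal_sup => _ [A [finA AT] <-].
  under eq_fsbigr do rewrite EFinM.
  rewrite -ge0_mule_fsumr; last by move=> ?; rewrite lee_fin.
  by apply: lee_wpmul2l; rewrite ?lee_fin//; apply: ereal_sup_ubound; exists A.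
rewrite le_eqVlt => /predU1P[<-|c0] f0.
  by rewrite mul0e esum1// => x _; rewrite mul0r.
apply/le_anti/andP; split; first by apply: H => //; exact: ltW.
(* The reverse inequality is [H] again, for the factor c^-1 and the family c f. *)
have := H c^-1 (fun x => c * f x) _ _.
under eq_esum do rewrite mulKf ?gt_eqF//.
rewrite invr_ge0 ltW// => /(_ isT) h.
rewrite -lee_pdivlMl//; apply: h.
by move=> x; rewrite mulr_ge0 // ltW.
Qed.

Lemma rsummableZ (c : R) f : rsummable f -> rsummable (fun x => c * f x).
Proof.
rewrite /rsummable => sf; under eq_esum do rewrite normrM.
by rewrite esumZ// lte_mul_pinfty// ?lee_fin//.
Qed.

Lemma rsummable_pos f : rsummable f -> rsummable f^\+ /\ rsummable f^\-.
Proof.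
move=> sf; have sa : rsummable (fun x => `|f x|).
  by rewrite /rsummable; under eq_esum do rewrite normr_id.
split; apply: rsummable_le sa => x.
  by rewrite ger0_norm ?funrpos_ge0// ge_max ler_norm /=.
by rewrite ger0_norm ?funrneg_ge0// ge_max -normrN ler_norm /=.
Qed.

(** [rsum] is defined by the positive and negative parts; here any difference of nonnegative
    summable families computes it. Additivity, negation and scaling then only regroup such
    differences. *)
Lemma rsumB p q : rsummable p -> rsummable q -> (forall x, 0 <= p x) ->
  (forall x, 0 <= q x) -> rsum (fun x => p x - q x) = nsum p - nsum q.
Proof.
move=> sp sq p0 q0.
have := @esumB R X setT (EFin \o p) (EFin \o q) sp sq (fun i _ => p0 i) (fun i _ => q0 i).
rewrite /= (rsummable_fin p0 sp) (rsummable_fin q0 sq).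
set f := fun x => p x - q x => E.
have f0 := funrpos_ge0 f; have f1 := funrneg_ge0 f.
have sf : rsummable f.
  apply: (@rsummable_le _ (p \+ q)); last exact: rsummableD.
  by move=> x; rewrite (le_trans (ler_normB _ _))// !ger0_norm.
have [sf0 sf1] := rsummable_pos sf.
apply: EFin_inj; rewrite /rsum !EFinB -(rsummable_fin f0 sf0) -(rsummable_fin f1 sf1) -E.
by congr (_ - _)%E; apply: eq_esum => x _; rewrite ?funeposE ?funenegE /= EFin_max.
Qed.

Lemma rsum_ge0E f : (forall x, 0 <= f x) -> rsummable f -> rsum f = nsum f.
Proof.
move=> f0 sf; rewrite -[RHS]subr0.
have s0 : rsummable (fun=> 0 : R).
  by rewrite /rsummable esum1// => x _; rewrite normr0.
have := rsumB sf s0 f0 (fun=> lexx 0).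
rewrite [in RHS](@esum1 _ _ _ (fun x => 0%:E))//= => <-.
by congr rsum; apply/funext => x; rewrite subr0.
Qed.

Lemma rsummable_split f : rsummable f -> exists p q,
  [/\ rsummable p, rsummable q, forall x, 0 <= p x, forall x, 0 <= q x
    & f = (fun x => p x - q x)].
Proof.
move=> sf; have [sp sq] := rsummable_pos sf; exists f^\+, f^\-; split => //.
by rewrite -[LHS]funrposBneg.
Qed.

Lemma nsumD p q : rsummable p -> rsummable q -> (forall x, 0 <= p x) ->
  (forall x, 0 <= q x) -> nsum (fun x => p x + q x) = nsum p + nsum q.
Proof.
move=> sp sq p0 q0; apply: EFin_inj.
rewrite EFinD -(rsummable_fin p0 sp) -(rsummable_fin q0 sq).
rewrite -(@rsummable_fin (p \+ q)) //; last 2 first.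
- by move=> x; rewrite addr_ge0.
- exact: rsummableD.
by rewrite -esumD// => x _; rewrite lee_fin.
Qed.

Lemma rsumD f g : rsummable f -> rsummable g ->
  rsum (fun x => f x + g x) = rsum f + rsum g.
Proof.
move=> /rsummable_split[p [q [sp sq p0 q0 ->]]].
move=> /rsummable_split[p' [q' [sp' sq' p0' q0' ->]]].
rewrite !rsumB//; transitivity (rsum (fun x => (p x + p' x) - (q x + q' x))).
  by congr rsum; apply/funext => x; ring.
rewrite (rsumB (rsummableD sp sp') (rsummableD sq sq')).
- by rewrite (nsumD sp sp' p0 p0') (nsumD sq sq' q0 q0'); ring.
- by move=> x; exact: addr_ge0.
- by move=> x; exact: addr_ge0.
Qed.

Lemma rsumN f : rsummable f -> rsum (fun x => - f x) = - rsum f.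
Proof.
move=> /rsummable_split[p [q [sp sq p0 q0 ->]]].
under eq_fun do rewrite opprB.
by rewrite !rsumB// opprB.
Qed.

Lemma rsumZ (c : R) f : rsummable f -> rsum (fun x => c * f x) = c * rsum f.
Proof.
wlog c0 : c / 0 <= c.
  move=> H sf; have [|c0] := leP 0 c; first by move=> /H ->.
  rewrite -[in LHS](opprK c); under eq_fun do rewrite mulNr.
  rewrite rsumN; last exact: rsummableZ.
  by rewrite H// ?oppr_ge0 ?ltW// mulNr opprK.
move=> /rsummable_split[p [q [sp sq p0 q0 ->]]].
under eq_fun do rewrite mulrBr.
rewrite !rsumB//; try exact: rsummableZ; try by move=> x; rewrite mulr_ge0.
rewrite !esumZ// (rsummable_fin p0 sp) (rsummable_fin q0 sq).
by rewrite -!EFinM mulrBr.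
Qed.

Lemma le_rsum f g : rsummable f -> rsummable g -> (forall x, f x <= g x) ->
  rsum f <= rsum g.
Proof.
move=> sf sg fg.
have sfg : rsummable (fun x => g x + - f x).
  apply: rsummableD => //; have := rsummableZ (-1) sf.
  by under eq_fun do rewrite mulN1r.
have -> : g = (fun x => f x + (g x + - f x)) by apply/funext => x; ring.
rewrite rsumD// lerDl rsum_ge0E//; last by move=> x; rewrite subr_ge0.
by apply: fine_ge0; apply: esum_ge0 => x _; rewrite lee_fin subr_ge0.
Qed.

(** A divergent sum is no exception, since [fine] sends it to 0. *)
Lemma rsum_ge0 f : (forall x, 0 <= f x) -> 0 <= rsum f.
Proof.
move=> f0; rewrite /rsum [X in _ - fine X]esum1 /= ?subr0.
  by apply: fine_ge0; apply: esum_ge0 => x _; rewrite lee_fin /funrpos le_max lexx orbT.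
by move=> x _; rewrite /funrneg max_r// oppr_le0.
Qed.

Lemma rsum_single (a : X) f : (forall x, x != a -> f x = 0) ->
  rsummable f /\ rsum f = f a.
Proof.
have H p : (forall x, 0 <= p x) -> (forall x, x != a -> p x = 0) ->
    \esum_(x in [set: X]) (p x)%:E = (p a)%:E.
  move=> p0 pa; rewrite -(@esum_set1 R X a (fun x => (p x)%:E)) ?lee_fin//.
  rewrite [RHS]esum_mkcond; apply: eq_esum => x _.
  have [->|xa] := eqVneq x a; first by rewrite ifT// inE.
  by rewrite pa// if_same.
move=> fa; split.
  by rewrite /rsummable H ?ltry// => x /fa ->; rewrite normr0.
have p0 := funrpos_ge0 f; have n0 := funrneg_ge0 f.
rewrite /rsum (H _ p0) ?(H _ n0); last 2 first.
- by move=> x /fa; rewrite /funrneg => ->; rewrite oppr0 maxxx.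
- by move=> x /fa; rewrite /funrpos => ->; rewrite maxxx.
by rewrite /= -[in RHS](funrposBneg f).
Qed.

Lemma rsum0 : rsum (fun _ : X => 0 : R) = 0.
Proof.
rewrite /rsum !esum1 ?subrr// => x _.
  by rewrite /funrneg oppr0 maxxx.
by rewrite /funrpos maxxx.
Qed.

End RealSums.

(** * Unordered sums of complex families *)

Section ComplexSums.
Context (R : realType) (X : choiceType).
Implicit Types f g : X -> R[i].

Definition csummable f :=
  rsummable (fun x => complex.Re (f x)) /\ rsummable (fun x => complex.Im (f x)).

Lemma csummable_cmod f p : (forall x, cmod (f x) <= p x) -> rsummable p ->
  csummable f.
Proof.
move=> fp sp; split; apply: rsummable_le sp => x; apply: le_trans (fp x).
  exact: Re_le_cmod.
exact: Im_le_cmod.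
Qed.

Lemma csumD f g : csummable f -> csummable g ->
  csum (fun x => f x + g x) = csum f + csum g.
Proof.
move=> [sf sf'] [sg sg']; rewrite /csum.
under eq_fun do rewrite cReD. under [X in _ +i* rsum X]eq_fun do rewrite cImD.
by rewrite !rsumD.
Qed.

Lemma csumZ (c : R[i]) f : csummable f -> csum (fun x => c * f x) = c * csum f.
Proof.
case: c => a b [sf sf']; rewrite /csum.
under eq_fun do rewrite cReM -mulNr. under [X in _ +i* rsum X]eq_fun do rewrite cImM.
rewrite !rsumD; try exact: rsummableZ.
by rewrite !rsumZ//= mulNr.
Qed.

Lemma csum_conj f : csummable f -> csum (fun x => (f x)^*) = (csum f)^*.
Proof.
move=> [sf sf']; rewrite /csum -[RHS]/(Complex (rsum _) (- rsum _)) -rsumN//.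
congr Complex; congr rsum; apply/funext => x; by case: (f x).
Qed.

Lemma csum_single (a : X) f : (forall x, x != a -> f x = 0) ->
  csum f = f a.
Proof.
move=> fa; rewrite /csum.
have [|_ ->] := @rsum_single R X a (fun x => complex.Re (f x)); first by move=> x /fa ->.
have [|_ ->] := @rsum_single R X a (fun x => complex.Im (f x)); first by move=> x /fa ->.
by case: (f a).
Qed.

End ComplexSums.

(** * The Hilbert space: inner product, Cauchy-Schwarz, completeness *)

Section L2.
Context (R : realType) (X : countType) (m : X -> R) (m0 : forall x, 0 < m x).
Implicit Types f g h : X -> R[i].
Local Notation l2 := (l2 m).
Local Notation inner := (inner m).

(** The squared norm, equal to [inner f f] on [l2]; estimates in it need no square roots. *)
Definition sqnorm f := rsum (fun x => cmod (f x) ^+ 2 * m x).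

Lemma sqnorm_term_ge0 f x : 0 <= cmod (f x) ^+ 2 * m x.
Proof. by rewrite mulr_ge0 ?sqr_ge0// ltW. Qed.

Lemma l2P f : l2 f <-> rsummable (fun x => cmod (f x) ^+ 2 * m x).
Proof. by rewrite rsummable_ge0//; exact: sqnorm_term_ge0. Qed.

Lemma l2_lin (a : R[i]) f g : l2 f -> l2 g -> l2 (fun x => a * f x + g x).
Proof.
move=> /l2P sf /l2P sg; apply/l2P.
apply: (@rsummable_le _ _ _ (fun x => (2 * cmod a ^+ 2) * (cmod (f x) ^+ 2 * m x) +
   2 * (cmod (g x) ^+ 2 * m x))); last by apply: rsummableD; exact: rsummableZ.
move=> x; rewrite ger0_norm; last exact: (@sqnorm_term_ge0 (fun x => a * f x + g x)).
rewrite !mulrA -mulrDl ler_wpM2r ?(ltW (m0 x))//.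
have := cmodD (a * f x) (g x); rewrite cmodM.
have := cmod_ge0 (a * f x + g x).
move: (cmod (a * f x + g x)) (cmod a) (cmod (f x)) (cmod (g x)) => u v w z u0 uv.
have : u ^+ 2 <= (v * w + z) ^+ 2 by rewrite ler_sqr ?nnegrE//; lra.
have := sqr_ge0 (v * w - z); nra.
Qed.

Lemma l2_delta a : l2 (delta R a).
Proof.
apply/l2P; have [|//] := @rsum_single R X a (fun x => cmod (delta R a x) ^+ 2 * m x).
by move=> x /negbTE xa; rewrite /delta xa cmod0 expr0n mul0r.
Qed.

Lemma l2_0 : l2 (fun=> 0).
Proof.
apply/l2P; rewrite rsummable_ge0; last by move=> x; rewrite cmod0 expr0n mul0r.
by rewrite esum1 ?ltry// => x _; rewrite cmod0 expr0n mul0r.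
Qed.

Lemma l2Z (a : R[i]) f : l2 f -> l2 (fun x => a * f x).
Proof.
by move=> lf; have := l2_lin a lf l2_0; under eq_fun do rewrite addr0.
Qed.

Lemma l2D f g : l2 f -> l2 g -> l2 (fun x => f x + g x).
Proof.
by move=> lf lg; have := l2_lin 1 lf lg; under eq_fun do rewrite mul1r.
Qed.

Lemma l2B f g : l2 f -> l2 g -> l2 (fun x => f x - g x).
Proof.
move=> lf lg; have := l2_lin (-1) lg lf.
by under eq_fun do rewrite mulN1r addrC.
Qed.

Lemma l2_sum (I : Type) (s : seq I) (F : I -> X -> R[i]) :
  (forall i, l2 (F i)) -> l2 (fun x => \sum_(i <- s) F i x).
Proof.
move=> lF; elim: s => [|i s IH].
  by under eq_fun do rewrite big_nil; exact: l2_0.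
by under eq_fun do rewrite big_cons; apply: l2D.
Qed.

Lemma inner_csummable f g : l2 f -> l2 g ->
  csummable (fun x => (f x)^* * g x * (m x)%:C).
Proof.
move=> /l2P sf /l2P sg.
apply: (@csummable_cmod _ _ _ (fun x => cmod (f x) ^+ 2 * m x + cmod (g x) ^+ 2 * m x)).
  move=> x; rewrite !cmodM cmod_conj cmodr (gtr0_norm (m0 x)) -mulrDl.
  rewrite ler_wpM2r ?(ltW (m0 x))//.
  have := cmod_ge0 (f x); have := cmod_ge0 (g x).
  move: (cmod (f x)) (cmod (g x)) => u v v0 u0; have := sqr_ge0 (u - v); nra.
exact: rsummableD.
Qed.

Lemma innerDr h f g : l2 h -> l2 f -> l2 g ->
  inner h (fun x => f x + g x) = inner h f + inner h g.
Proof.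
move=> lh lf lg; rewrite /inner -csumD; try exact: inner_csummable.
by congr csum; apply/funext => x; ring.
Qed.

Lemma innerZr h (a : R[i]) f : l2 h -> l2 f ->
  inner h (fun x => a * f x) = a * inner h f.
Proof.
move=> lh lf; rewrite /inner -csumZ; try exact: inner_csummable.
by congr csum; apply/funext => x; ring.
Qed.

Lemma inner_conj f g : l2 f -> l2 g -> inner g f = (inner f g)^*.
Proof.
move=> lf lg; rewrite /inner -csum_conj; last exact: inner_csummable.
congr csum; apply/funext => x; rewrite !rmorphM /= conjCK conj_real.
by rewrite [f x * _]mulrC.
Qed.

Lemma innerDl h f g : l2 h -> l2 f -> l2 g ->
  inner (fun x => f x + g x) h = inner f h + inner g h.
Proof.
move=> lh lf lg; rewrite (inner_conj lh (l2D lf lg)) innerDr//.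
by rewrite (inner_conj lh lf) (inner_conj lh lg) -rmorphD.
Qed.

Lemma innerZl h (a : R[i]) f : l2 h -> l2 f ->
  inner (fun x => a * f x) h = a^* * inner f h.
Proof.
move=> lh lf; rewrite (inner_conj lh (l2Z _ lf)) innerZr//.
by rewrite (inner_conj lh lf); exact: (rmorphM (@conjc R)).
Qed.

Lemma innerBr h f g : l2 h -> l2 f -> l2 g ->
  inner h (fun x => f x - g x) = inner h f - inner h g.
Proof.
move=> lh lf lg; have := innerDr lh lf (l2Z (-1) lg).
by under eq_fun do rewrite mulN1r; rewrite innerZr// mulN1r.
Qed.

Lemma innerBl h f g : l2 h -> l2 f -> l2 g ->
  inner (fun x => f x - g x) h = inner f h - inner g h.
Proof.
move=> lh lf lg; rewrite (inner_conj lh (l2B lf lg)) innerBr//.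
by rewrite (inner_conj lh lf) (inner_conj lh lg) -rmorphB.
Qed.

Lemma inner0r h : inner h (fun=> 0) = 0.
Proof.
rewrite /inner /csum; under eq_fun do rewrite mulr0 mul0r.
by under [X in _ +i* rsum X]eq_fun do rewrite mulr0 mul0r; rewrite rsum0.
Qed.

Lemma inner0l h : l2 h -> inner (fun=> 0) h = 0.
Proof. by move=> lh; rewrite (inner_conj lh l2_0) inner0r rmorph0. Qed.

Lemma inner_sumr (I : Type) (s : seq I) (F : I -> X -> R[i]) h : l2 h ->
  (forall i, l2 (F i)) ->
  inner h (fun x => \sum_(i <- s) F i x) = \sum_(i <- s) inner h (F i).
Proof.
move=> lh lF; elim: s => [|i s IH].
  by under eq_fun do rewrite big_nil; rewrite inner0r big_nil.
under eq_fun do rewrite big_cons; rewrite innerDr//; last exact: l2_sum.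
by rewrite IH big_cons.
Qed.

Lemma inner_sqnorm f : l2 f -> inner f f = (sqnorm f)%:C.
Proof.
move=> lf; rewrite /inner /csum /sqnorm -[RHS]/(_ +i* 0) -(@rsum0 R X).
congr Complex; congr rsum; apply/funext => x.
  by rewrite cmod_sq; case: (f x) => a b /=; ring.
by case: (f x) => a b /=; ring.
Qed.

Lemma Re_inner f : l2 f -> complex.Re (inner f f) = sqnorm f.
Proof. by move=> lf; rewrite inner_sqnorm. Qed.

Lemma sqnorm_ge0 f : 0 <= sqnorm f.
Proof. by apply: rsum_ge0; exact: sqnorm_term_ge0. Qed.

Lemma l2norm_sq f : l2 f -> l2norm m f ^+ 2 = sqnorm f.
Proof. by move=> lf; rewrite /l2norm Re_inner// sqr_sqrtr// sqnorm_ge0. Qed.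

Lemma sqnormZ (a : R[i]) f : l2 f -> sqnorm (fun x => a * f x) = cmod a ^+ 2 * sqnorm f.
Proof.
move=> /l2P lf; rewrite /sqnorm -rsumZ//.
by congr rsum; apply/funext => x; rewrite cmodM; ring.
Qed.

Lemma sqnormB f g : l2 f -> l2 g ->
  sqnorm (fun x => f x - g x) = sqnorm f + sqnorm g - 2 * complex.Re (inner f g).
Proof.
move=> lf lg; apply: complexI; rewrite -inner_sqnorm; last exact: l2B.
rewrite innerBr//; last exact: l2B.
rewrite !innerBl// (inner_conj lf lg) !inner_sqnorm//.
by case: (inner f g) => a b; apply/eqP; rewrite eq_complex /=; apply/andP; split; apply/eqP; ring.
Qed.

(** The parallelogram law with the square of |f - g| dropped. *)
Lemma sqnormD_le f g : l2 f -> l2 g ->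
  sqnorm (fun x => f x + g x) <= 2 * sqnorm f + 2 * sqnorm g.
Proof.
move=> lf lg; have lNg := l2Z (-1) lg.
have E : (fun x => f x - -1 * g x) = (fun x => f x + g x).
  by apply/funext => x; rewrite mulN1r opprK.
have := sqnormB lf lNg; have := sqnormB lf lg; rewrite E innerZr// sqnormZ//.
rewrite cmodN (cmodr (1 : R)) normr1 expr1n mul1r mulN1r.
have := sqnorm_ge0 (fun x => f x - g x).
by case: (inner f g) => a b /=; lra.
Qed.

Lemma cauchy_schwarz f g : l2 f -> l2 g ->
  cmod (inner f g) ^+ 2 <= sqnorm f * sqnorm g.
Proof.
move=> lf lg; set w := inner f g.
(* The expansion of |f - s w^* g|^2: the factor w^* makes the cross term real. For g of positive
   norm the minimum is at s = 1 / |g|^2, used at the end. *)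
have H (s : R) : 0 <= sqnorm f - 2 * s * cmod w ^+ 2 + s ^+ 2 * cmod w ^+ 2 * sqnorm g.
  have := sqnorm_ge0 (fun x => f x - (s%:C * w^*) * g x).
  rewrite sqnormB ?innerZr ?sqnormZ//; last exact: l2Z.
  rewrite -/w cmodM cmodr cmod_conj exprMn real_normK ?num_real//.
  rewrite (_ : complex.Re _ = s * cmod w ^+ 2); last first.
    by rewrite cmod_sq; case: w => a b /=; ring.
  lra.
have := sqnorm_ge0 f; have := sqnorm_ge0 g; have := sqr_ge0 (cmod w).
move: (cmod w ^+ 2) (sqnorm f) (sqnorm g) H => W F G H W0 G0 F0.
move: G0; rewrite le_eqVlt => /predU1P[G0|G0].
  rewrite -G0 mulr0 leNgt; apply/negP => W1.
  (* For |g| = 0 the expression [H] is affine in s, and this s gives it the value -1. *)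
  have := H ((F + 1) / (2 * W)); rewrite -G0 mulr0 addr0.
  have -> : 2 * ((F + 1) / (2 * W)) * W = F + 1 by field; rewrite gt_eqF.
  lra.
have := H G^-1; rewrite (_ : _ + _ = F - W / G); last by field; rewrite gt_eqF.
by rewrite subr_ge0 ler_pdivrMr.
Qed.

Lemma cauchy_schwarz_norm f g : l2 f -> l2 g ->
  cmod (inner f g) <= l2norm m f * l2norm m g.
Proof.
move=> lf lg; rewrite -(@ler_pXn2r _ 2) ?nnegrE ?cmod_ge0 ?mulr_ge0 ?sqrtr_ge0//.
by rewrite exprMn !l2norm_sq// cauchy_schwarz.
Qed.

Lemma inner_delta x g : inner (delta R x) g = g x * (m x)%:C.
Proof.
rewrite /inner (@csum_single _ _ x); last first.
  by move=> y /negbTE yx; rewrite /delta yx mulr0n rmorph0 !mul0r.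
by rewrite /delta eqxx mulr1n rmorph1 mul1r.
Qed.

Lemma inner_delta_inj f g :
  (forall x, inner (delta R x) f = inner (delta R x) g) -> f = g.
Proof.
move=> H; apply/funext => x; have := H x; rewrite !inner_delta.
by apply: mulIf; rewrite -[0]/(0%:C) (inj_eq (@complexI R)) gt_eqF.
Qed.

Lemma esum_sqnorm f : l2 f ->
  \esum_(x in [set: X]) (cmod (f x) ^+ 2 * m x)%:E = (sqnorm f)%:E.
Proof.
move=> lf; have sf := (l2P f).1 lf; rewrite (rsummable_fin (sqnorm_term_ge0 f) sf).
by rewrite /sqnorm (rsum_ge0E (sqnorm_term_ge0 f) sf).
Qed.

Lemma sqnorm_ge_fset f (A : set X) : l2 f -> finite_set A ->
  \sum_(x \in A) (cmod (f x) ^+ 2 * m x) <= sqnorm f.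
Proof.
move=> lf finA; rewrite -lee_fin -esum_sqnorm// -fsumEFin//; apply: ereal_sup_ubound.
by exists A.
Qed.

(** Fatou's lemma for counting: bounds on finite sets survive pointwise limits, so this is how a
    pointwise limit is shown to lie in [l2]. *)
Lemma l2_of_fset f (c : R) :
  (forall A : set X, finite_set A -> \sum_(x \in A) (cmod (f x) ^+ 2 * m x) <= c) ->
  l2 f /\ sqnorm f <= c.
Proof.
move=> H.
have E : (\esum_(x in [set: X]) (cmod (f x) ^+ 2 * m x)%:E <= c%:E)%E.
  by apply: ge_ereal_sup => _ [A [finA _] <-]; rewrite fsumEFin// lee_fin H.
have lf : l2 f by rewrite /Defs.l2 /=; apply: le_lt_trans E (ltry _).
by split => //; rewrite -lee_fin -esum_sqnorm.
Qed.

(** The explicit bounds c i + c j let the limit inherit the rate c n. The limit is taken pointwise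
    in real and imaginary parts; on a finite set the bound passes to j -> oo, and [l2_of_fset]
    extends it to X. *)
Lemma l2_complete (g : nat -> X -> R[i]) (c : nat -> R) :
  (forall n, l2 (g n)) -> c @ \oo --> (0 : R) ->
  (forall i j, sqnorm (fun x => g i x - g j x) <= c i + c j) ->
  exists h, l2 h /\ forall n, sqnorm (fun x => g n x - h x) <= c n.
Proof.
move=> lg c0 gc.
have pt i j x : cmod (g i x - g j x) ^+ 2 * m x <= c i + c j.
  apply: le_trans (gc i j).
  have := @sqnorm_ge_fset (fun x => g i x - g j x) [set x] (l2B (lg i) (lg j)) (finite_set1 x).
  by rewrite fsbig_set1.
have cv (F : R[i] -> R) x : (forall z w, F (z - w) = F z - F w) ->
    (forall z, `|F z| <= cmod z) -> cvg (F (g n x) @[n --> \oo]).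
  move=> FB Fc; apply/cauchy_cvgP/cauchy_exP => e e0.
  (* Half of e^2 m x for each of the two indices in [pt]. *)
  have : \forall n \near \oo, `|c n| < e ^+ 2 * m x / 2.
    have /cvgr0_norm_lt := c0; apply.
    by rewrite divr_gt0// mulr_gt0// exprn_gt0.
  move=> [N _ HN]; exists (F (g N x)), N => // n Nn; rewrite /ball /= -FB.
  apply: le_lt_trans (Fc _) _.
  rewrite -(ltr_pXn2r (n:=2)) ?nnegrE ?cmod_ge0 ?(ltW e0)//.
  rewrite -(ltr_pM2r (m0 x)); apply: le_lt_trans (pt _ _ _) _.
  have := HN N (leqnn N); have := HN n Nn => /=.
  have := ler_norm (c n); have := ler_norm (c N); lra.
have cR x : cvg (complex.Re (g n x) @[n --> \oo]).
  by apply: cv; [case=> a b [a' b'] | exact: Re_le_cmod].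
have cI x : cvg (complex.Im (g n x) @[n --> \oo]).
  by apply: cv; [case=> a b [a' b'] | exact: Im_le_cmod].
pose h x := lim (complex.Re (g n x) @[n --> \oo]) +i* lim (complex.Im (g n x) @[n --> \oo]).
have ch n x : cmod (g n x - g j x) ^+ 2 * m x @[j --> \oo] --> cmod (g n x - h x) ^+ 2 * m x.
  apply: cvgMl; rewrite cmod_sq cReB cImB.
  under eq_fun do rewrite cmod_sq cReB cImB.
  have sq (u : nat -> R) (a b : R) : u j @[j --> \oo] --> a ->
      (b - u j) ^+ 2 @[j --> \oo] --> (b - a) ^+ 2.
    move=> ua; rewrite expr2; under eq_fun do rewrite expr2.
    by apply: cvgM; apply: cvgB => //; exact: cvg_cst.
  by apply: cvgD; apply: sq; [exact: cR | exact: cI].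
have H n : l2 (fun x => g n x - h x) /\ sqnorm (fun x => g n x - h x) <= c n.
{ apply: l2_of_fset => A finA.
  apply: (@ler_cvg_to _ \oo _ _ (fun j => \sum_(x \in A) (cmod (g n x - g j x) ^+ 2 * m x))
    (fun j => c n + c j)).
  - rewrite fsbig_finite//; under eq_cvg do rewrite fsbig_finite//.
    by apply: cvg_big => [|x _]; [exact: add_continuous | exact: ch].
  - by rewrite -[X in _ --> X]addr0; apply: cvgD => //; exact: cvg_cst.
  - apply: nearW => j; apply: le_trans (gc n j).
    by apply: sqnorm_ge_fset => //; exact: l2B. }
exists h; split; last by move=> n; case: (H n).
have := l2B (lg 0%N) (H 0%N).1.
by under eq_fun do rewrite subKr.
Qed.

Lemma l2norm_le f (c : R) : l2 f -> sqnorm f <= c -> l2norm m f <= Num.sqrt c.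
Proof. by move=> lf fc; rewrite /l2norm Re_inner// ler_wsqrtr. Qed.

Lemma inner_cvg (u v : nat -> X -> R[i]) f g (c d : nat -> R) :
  (forall n, l2 (u n)) -> (forall n, l2 (v n)) -> l2 f -> l2 g ->
  c @ \oo --> (0 : R) -> d @ \oo --> (0 : R) ->
  (forall n, sqnorm (fun x => u n x - f x) <= c n) ->
  (forall n, sqnorm (fun x => v n x - g x) <= d n) ->
  cmod (inner (u n) (v n) - inner f g) @[n --> \oo] --> (0 : R).
Proof.
move=> lu lv lf lg c0 d0 uc vd.
have sq (e : nat -> R) : e @ \oo --> (0 : R) -> Num.sqrt (e n) @[n --> \oo] --> (0 : R).
  by move=> e0; rewrite -[X in _ --> X]sqrtr0; apply: continuous_cvg => //; exact: sqrt_continuous.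
pose b n := Num.sqrt (c n) * Num.sqrt (d n) + l2norm m f * Num.sqrt (d n)
  + Num.sqrt (c n) * l2norm m g.
apply: (@squeeze_cvgr _ _ _ _ (fun=> 0) b); last 2 first.
- exact: cvg_cst.
- rewrite -[X in _ --> X](_ : 0 * 0 + l2norm m f * 0 + 0 * l2norm m g = 0); last by ring.
  by apply: cvgD; [apply: cvgD; [apply: cvgM|apply: cvgMr]|apply: cvgMl]; exact: sq.
apply: nearW => n; rewrite cmod_ge0 andTb.
have lun := l2B (lu n) lf; have lvn := l2B (lv n) lg.
rewrite [X in cmod X](_ : _ =
    inner (fun x => u n x - f x) (fun x => v n x - g x) +
    inner f (fun x => v n x - g x) + inner (fun x => u n x - f x) g); last first.
  by rewrite !innerBl// !innerBr//; ring.
have uc' := l2norm_le lun (uc n); have vd' := l2norm_le lvn (vd n).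
rewrite /b; apply: le_trans (cmodD _ _) _; apply: lerD.
  apply: le_trans (cmodD _ _) _; apply: lerD.
    by apply: le_trans (cauchy_schwarz_norm lun lvn) _; rewrite ler_pM// sqrtr_ge0.
  by apply: le_trans (cauchy_schwarz_norm lf lvn) _; rewrite ler_wpM2l// sqrtr_ge0.
by apply: le_trans (cauchy_schwarz_norm lun lg) _; rewrite ler_wpM2r// sqrtr_ge0.
Qed.

End L2.

(** * The finite measures <f, P(B) f> *)

Section SpectralMeasure.
Context (R : realType) (X : countType) (m : X -> R) (m0 : forall x, 0 < m x).
Context (P : set R -> (X -> R[i]) -> X -> R[i]).
Implicit Types (f g h : X -> R[i]) (B : set R).
Local Notation l2 := (l2 m).
Local Notation inner := (inner m).
Local Notation sqn := (sqnorm m).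
Context (hP : projection_valued_measure m P).

Lemma pvm_l2 B f : measurable B -> l2 f -> l2 (P B f).
Proof. by move=> mB lf; have [[_ + _ _ _] _ _] := pvm_projection hP mB; apply. Qed.

Lemma pvm_lin B (a : R[i]) f g : measurable B -> l2 f -> l2 g ->
  P B (fun x => a * f x + g x) = (fun x => a * P B f x + P B g x).
Proof. by move=> mB lf; have [[_ _ _ _ +] _ _] := pvm_projection hP mB; apply. Qed.

Lemma pvm_sym B f g : measurable B -> l2 f -> l2 g ->
  inner (P B f) g = inner f (P B g).
Proof. by move=> mB lf lg; have [_ _ ->] := pvm_projection hP mB. Qed.

Lemma pvm_inner B B' f g : measurable B -> measurable B' -> l2 f -> l2 g ->
  inner (P B f) (P B' g) = inner f (P (B `&` B') g).
Proof.
move=> mB mB' lf lg; rewrite (pvmI hP)// pvm_sym//.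
exact: pvm_l2.
Qed.

Lemma pvm_sqnorm B f : measurable B -> l2 f ->
  inner f (P B f) = (sqn (P B f))%:C.
Proof.
by move=> mB lf; rewrite -{1}(setIid B) -pvm_inner// inner_sqnorm//; exact: pvm_l2.
Qed.

Lemma pvmZ B (a : R[i]) f : measurable B -> l2 f ->
  P B (fun x => a * f x) = (fun x => a * P B f x).
Proof.
move=> mB lf; have l0 := l2_0 m0.
have P0 : P B (fun=> 0) = (fun=> 0).
  have := pvm_lin (-1) mB l0 l0.
  rewrite (_ : (fun _ => _) = (fun=> 0)); last by apply/funext => x; rewrite mulr0 addr0.
  by move=> ->; apply/funext => x; rewrite mulN1r addNr.
have := pvm_lin a mB lf l0; rewrite P0.
by under eq_fun do rewrite addr0; under [in RHS]eq_fun do rewrite addr0.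
Qed.

Lemma pvmD B f g : measurable B -> l2 f -> l2 g ->
  P B (fun x => f x + g x) = (fun x => P B f x + P B g x).
Proof.
move=> mB lf lg; have := pvm_lin 1 mB lf lg.
by under eq_fun do rewrite mul1r; under [in RHS]eq_fun do rewrite mul1r.
Qed.

(* The library asks for measures to be nonnegative on all sets, while nothing is
   known about [P B] for nonmeasurable [B]. The unused arguments are there for
   the inference of the measure structure. *)
Definition smeas (_ : forall x, 0 < m x) (_ : projection_valued_measure m P)
    f (_ : l2 f) (B : set R) : \bar R :=
  (if `[< measurable B >] then sqn (P B f) else 0)%:E.

Section Measure.
Context (f : X -> R[i]) (lf : l2 f).

Lemma smeas_sqnorm B : measurable B -> smeas m0 hP lf B = (sqn (P B f))%:E.
Proof. by move=> mB; rewrite /smeas ifT//; apply/asboolP. Qed.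

Lemma smeasE B : measurable B -> smeas m0 hP lf B = spectral_measure m P f B.
Proof. by move=> mB; rewrite smeas_sqnorm// /spectral_measure pvm_sqnorm. Qed.

Let smeas0 : smeas m0 hP lf set0 = 0%E.
Proof.
rewrite smeas_sqnorm// (pvm0 hP)// /sqnorm.
by under eq_fun do rewrite cmod0 expr0n mul0r; rewrite rsum0.
Qed.

Let smeas_ge0 B : (0 <= smeas m0 hP lf B)%E.
Proof. by rewrite /smeas; case: ifPn => // _; rewrite lee_fin sqnorm_ge0. Qed.

(** The partial sums are <f, S_n>, and Cauchy-Schwarz bounds their distance to <f, P(U) f> by |f|
    times the norm that tends to 0 by [pvm_sigma_additive]. *)
Let smeas_sigma_additive : semi_sigma_additive (smeas m0 hP lf).
Proof.
move=> F mF tF mUF; have := pvm_sigma_additive hP mF tF lf.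
rewrite smeas_sqnorm//.
set S := fun n x => \sum_(k < n) P (F k) f x.
set PU := P _ f => H.
have lU : l2 PU by exact: pvm_l2.
have lS n : l2 (S n) by apply: l2_sum => // k; exact: pvm_l2.
rewrite (_ : (fun n => _) = (fun n => (complex.Re (inner f (S n)))%:E)); last first.
  apply/funext => n; rewrite big_mkord inner_sumr//; last by move=> k; exact: pvm_l2.
  rewrite (eq_bigr (fun i : 'I_n => (sqn (P (F i) f))%:E)); last by move=> i _; rewrite smeas_sqnorm.
  rewrite (eq_bigr (fun i : 'I_n => (sqn (P (F i) f))%:C)); last by move=> i _; rewrite pvm_sqnorm.
  by rewrite sumEFin -rmorph_sum.
rewrite (_ : sqn PU = complex.Re (inner f PU)); last by rewrite pvm_sqnorm.
apply: cvg_EFin; first by apply: nearW.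
apply/cvgrPdist_le => e e0.
(* The added 1 keeps the denominator positive when f = 0. *)
have /cvgr0Pnorm_le /(_ (e / (l2norm m f + 1))) := H.
have n0 : 0 <= l2norm m f by exact: sqrtr_ge0.
case; first by rewrite divr_gt0// ltr_pwDr.
move=> N _ HN; exists N => // n /HN /= {}HN.
rewrite -[leLHS]/(`|complex.Re (inner f PU) - complex.Re (inner f (S n))|).
rewrite -cReB -innerBr//; apply: le_trans (Re_le_cmod _) _.
apply: le_trans (cauchy_schwarz_norm m0 lf (l2B m0 lU (lS n))) _.
rewrite ger0_norm ?sqrtr_ge0// in HN.
apply: le_trans (ler_wpM2l n0 HN) _.
rewrite mulrCA ler_piMr ?(ltW e0)// ler_pdivrMr ?mul1r; lra.
Qed.

HB.instance Definition _ := isMeasure.Build _ _ _ (smeas m0 hP lf)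
  smeas0 smeas_ge0 smeas_sigma_additive.

Lemma smeas_fin : fin_num_fun (smeas m0 hP lf).
Proof. by move=> B mB; rewrite smeas_sqnorm. Qed.

HB.instance Definition _ := Measure_isFinite.Build _ _ _ (smeas m0 hP lf) smeas_fin.

(* The library integral only evaluates its measure on measurable sets. *)
Lemma integral_smeas (D : set R) (phi : R -> \bar R) :
  (\int[spectral_measure m P f]_(l in D) phi l = \int[smeas m0 hP lf]_(l in D) phi l)%E.
Proof.
rewrite /integral; congr (ereal_sup _ - ereal_sup _)%E.
all: apply/seteqP; split => _ [h hg <-]; exists h => //; rewrite /sintegral.
all: by apply: eq_fsbigr => x _; rewrite smeasE//; exact: measurable_funPTI.
Qed.

End Measure.

End SpectralMeasure.

(** * Integrals against spectral measures and their polarized forms *)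

Section SpectralForm.
Context (R : realType) (X : countType) (m : X -> R) (m0 : forall x, 0 < m x).
Context (P : set R -> (X -> R[i]) -> X -> R[i]).
Implicit Types (f g h : X -> R[i]) (B : set R) (phi psi : R -> R).
Local Notation l2 := (l2 m).
Local Notation sqn := (sqnorm m).
Context (hP : projection_valued_measure m P).

Definition spectral_int phi f : R := fine (\int[spectral_measure m P f]_l (phi l)%:E).

(** Integrability against the spectral measure of f. It is stated with [spectral_measure], which
    unlike [smeas] carries no proof of [l2 f], so f can vary freely. *)
Definition L1 phi f := [/\ l2 f, measurable_fun [set: R] phi &
  (\int[spectral_measure m P f]_l `|phi l|%:E < +oo)%E].

Local Notation smeas lf := (smeas m0 hP lf).

Lemma L1P phi f (lf : l2 f) : L1 phi f <-> (smeas lf).-integrable setT (EFin \o phi).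
Proof.
split=> [[_ mphi]|/integrableP[/measurable_EFinP mphi]].
  rewrite (integral_smeas m0 hP lf) => H; apply/integrableP; split => //.
  exact/measurable_EFinP.
by split => //; rewrite (integral_smeas m0 hP lf).
Qed.

Lemma spectral_intE phi f (lf : l2 f) : spectral_int phi f = (\int[smeas lf]_l phi l)%R.
Proof. by rewrite /spectral_int (integral_smeas m0 hP lf). Qed.

Lemma L1_meas phi f : L1 phi f -> measurable_fun setT phi.
Proof. by case. Qed.

Lemma L1_le phi psi f : measurable_fun setT phi -> (forall l, `|phi l| <= psi l) ->
  L1 psi f -> L1 phi f.
Proof.
move=> mphi le H; have [lf _ _] := H; move: H => /(L1P _ lf) ipsi; apply/(L1P _ lf).
apply: le_integrable ipsi => //; first exact/measurable_EFinP.
by move=> l _; rewrite lee_fin (le_trans (le l))// ler_norm.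
Qed.

Lemma L1_lin a phi psi f : L1 phi f -> L1 psi f -> L1 (fun l => a * phi l + psi l) f.
Proof.
move=> H; have [lf _ _] := H; move: H => /(L1P _ lf) i1 /(L1P _ lf) i2; apply/(L1P _ lf).
by have := integrableD measurableT (integrableZl measurableT a i1) i2; exact.
Qed.

Lemma L1_cst a f : l2 f -> L1 (fun=> a) f.
Proof.
by move=> lf; apply/(L1P _ lf); exact: finite_measure_integrable_cst.
Qed.

Lemma L1_bounded phi (c : R) f : l2 f -> measurable_fun setT phi ->
  (forall l, `|phi l| <= c) -> L1 phi f.
Proof. by move=> lf mphi le; apply: L1_le le (L1_cst c lf). Qed.

Lemma L1_norm phi f : L1 phi f -> L1 (fun l => `|phi l|) f.
Proof.
move=> H; have [lf _ _] := H; move: H => /(L1P _ lf) i1; apply/(L1P _ lf).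
exact: integrable_norm.
Qed.

Lemma L1_scale a phi f : L1 phi f -> L1 (fun l => a * phi l) f.
Proof.
move=> H; have [lf _ _] := H; have := L1_lin a H (L1_cst 0 lf).
by under eq_fun do rewrite addr0.
Qed.

Lemma spectral_int_lin a phi psi f : L1 phi f -> L1 psi f ->
  spectral_int (fun l => a * phi l + psi l) f = a * spectral_int phi f + spectral_int psi f.
Proof.
move=> H; have [lf _ _] := H; move: H => /(L1P _ lf) i1 /(L1P _ lf) i2.
rewrite !(spectral_intE _ lf) RintegralD ?RintegralZl//.
exact: (integrableZl _ a i1).
Qed.

Lemma spectral_int_add phi psi f : L1 phi f -> L1 psi f ->
  spectral_int (fun l => phi l + psi l) f = spectral_int phi f + spectral_int psi f.
Proof.
by move=> p q; have := spectral_int_lin 1 p q; under eq_fun do rewrite mul1r; rewrite mul1r.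
Qed.

Lemma spectral_int0 f : l2 f -> spectral_int (fun=> 0) f = 0.
Proof. by move=> lf; rewrite (spectral_intE _ lf) /Rintegral integral0. Qed.

Lemma spectral_int_scale a phi f : L1 phi f -> spectral_int (fun l => a * phi l) f = a * spectral_int phi f.
Proof.
move=> p; have [lf _ _] := p; have := spectral_int_lin a p (L1_cst 0 lf).
by under eq_fun do rewrite addr0; rewrite spectral_int0// addr0.
Qed.

Lemma spectral_int_le phi psi f : L1 phi f -> L1 psi f -> (forall l, phi l <= psi l) ->
  spectral_int phi f <= spectral_int psi f.
Proof.
move=> H; have [lf _ _] := H; move: H => /(L1P _ lf) i1 /(L1P _ lf) i2 le.
by rewrite !(spectral_intE _ lf); apply: le_Rintegral.
Qed.

Lemma spectral_int_abs phi f : L1 phi f -> `|spectral_int phi f| <= spectral_int (fun l => `|phi l|) f.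
Proof.
move=> H; have [lf _ _] := H; move: H => /(L1P _ lf) i1.
by rewrite !(spectral_intE _ lf); apply: le_normr_Rintegral.
Qed.

Lemma spectral_int_indic B f : measurable B -> l2 f -> spectral_int \1_B f = sqn (P B f).
Proof.
move=> mB lf; rewrite (spectral_intE _ lf) /Rintegral integral_indic// setIT.
exact: (congr1 fine (smeas_sqnorm m0 hP lf mB)).
Qed.

Lemma L1_indic B f : measurable B -> l2 f -> L1 \1_B f.
Proof.
move=> mB lf; apply: (@L1_bounded _ 1) => //.
by move=> l; rewrite indicE; case: (_ \in _); rewrite ?normr1 ?normr0.
Qed.

Lemma spectral_int_cvg (phi_ : nat -> R -> R) phi psi f :
  (forall n, measurable_fun setT (phi_ n)) -> measurable_fun setT phi ->
  (forall l, phi_ n l @[n --> \oo] --> phi l) ->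
  (forall n l, `|phi_ n l| <= psi l) -> L1 psi f ->
  spectral_int (phi_ n) f @[n --> \oo] --> spectral_int phi f.
Proof.
move=> m_ mphi cphi le H; have [lf _ _] := H; move: H => /(L1P _ lf) ipsi.
have := @dominated_convergence _ _ _ (smeas lf) setT measurableT
  (fun n l => (phi_ n l)%:E) (EFin \o phi) (EFin \o psi).
case.
- by move=> n; exact/measurable_EFinP.
- exact/measurable_EFinP.
- by apply: aeW => l _; apply: cvg_EFin; [exact: nearW | exact: cphi].
- by [].
- by apply: aeW => l n _ /=; rewrite lee_fin.
move=> iphi _; rewrite -(fineK (integrable_fin_num measurableT iphi)).
move=> /fine_cvg; rewrite (spectral_intE _ lf) => H.
rewrite (_ : (fun n => _) = (fun n => (\int[smeas lf]_l phi_ n l)%R)) //.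
by apply/funext => n; rewrite (spectral_intE _ lf).
Qed.

Lemma sqnorm_pvm_lin B (a : R[i]) f h : measurable B -> l2 f -> l2 h ->
  sqn (P B (fun x => f x + a * h x)) <= 2 * sqn (P B f) + 2 * cmod a ^+ 2 * sqn (P B h).
Proof.
move=> mB lf lh; rewrite (pvmD hP)//; last exact: l2Z.
rewrite (pvmZ m0 hP)//.
have lPf := pvm_l2 hP mB lf; have lPh := pvm_l2 hP mB lh.
apply: le_trans (sqnormD_le m0 lPf (l2Z m0 a lPh)) _.
by rewrite (sqnormZ m0 a lPh) mulrA.
Qed.

(** The spectral measure is quadratic in the vector, not linear. By [sqnorm_pvm_lin] that of f + a h
    is at most 2 mu_f + 2 |a|^2 mu_h, where mu_u is the spectral measure of u; this makes the
    integrals over the polarized vectors f + i^k h finite. *)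
Lemma spectral_integral_add (psi : R -> R) (a : R[i]) f h : l2 f -> l2 h ->
  measurable_fun setT psi -> (forall l, 0 <= psi l) ->
  (\int[spectral_measure m P f]_l (psi l)%:E < +oo)%E ->
  (\int[spectral_measure m P h]_l (psi l)%:E < +oo)%E ->
  (\int[spectral_measure m P (fun x => f x + a * h x)%R]_l (psi l)%:E < +oo)%E.
Proof.
move=> lf lh mpsi psi0.
have lv : l2 (fun x => f x + a * h x) by apply: l2D => //; exact: l2Z.
rewrite (integral_smeas m0 hP lf) (integral_smeas m0 hP lh) (integral_smeas m0 hP lv).
move=> If Ih.
have c0 : 0 <= 2 * cmod a ^+ 2 by rewrite mulr_ge0// sqr_ge0.
pose mu := measure_add (mscale (NngNum (ler0n R 2)) (smeas lf))
   (mscale (NngNum c0) (smeas lh)).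
have mE : measurable_fun setT (fun l => (psi l)%:E) by exact/measurable_EFinP.
apply: (@le_lt_trans _ _ (\int[mu]_l (psi l)%:E)%E).
  apply: ge0_le_measure_integral => //.
  move=> B mB; rewrite [leLHS](smeas_sqnorm m0 hP lv mB).
  apply: (@le_trans _ _ (2 * sqn (P B f) + 2 * cmod a ^+ 2 * sqn (P B h))%:E).
    by rewrite lee_fin sqnorm_pvm_lin.
  rewrite [leRHS](measure_addE _ _ B) EFinD; apply: leeD.
    by rewrite EFinM -(smeas_sqnorm m0 hP lf mB); exact: lexx.
  by rewrite EFinM -(smeas_sqnorm m0 hP lh mB); exact: lexx.
have psi0' l : [set: R] l -> (0 <= (psi l)%:E)%E by rewrite lee_fin.
rewrite ge0_integral_measure_add//; apply: lte_add_pinfty.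
  rewrite [ltLHS](@ge0_integral_mscale _ _ _ (smeas lf) setT measurableT)//.
  by apply: lte_mul_pinfty.
rewrite [ltLHS](@ge0_integral_mscale _ _ _ (smeas lh) setT measurableT)//.
by apply: lte_mul_pinfty; rewrite ?lee_fin.
Qed.

Lemma L1_add phi (a : R[i]) f h : L1 phi f -> L1 phi h ->
  L1 phi (fun x => f x + a * h x).
Proof.
move=> [lf mphi If] [lh _ Ih]; split.
- by apply: l2D => //; exact: l2Z.
- exact: mphi.
- by apply: spectral_integral_add If Ih => //; exact: measurableT_comp.
Qed.

(** For real [phi] this is <h, phi(L) f>, as [fcalc_spec] shows. As an integral it makes sense for
    every [phi] integrable for f and h, even when f is outside the domain of phi(L). *)
Definition real_form phi h f := spectral_form m P (fun l => (phi l)%:C) h f.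

Local Notation pol f h k := (fun x => f x + 'i%C ^+ k * h x).

Lemma l2_pol f h k : l2 f -> l2 h -> l2 (pol f h k).
Proof. by move=> lf lh; apply: l2D => //; exact: l2Z. Qed.

Lemma real_formE phi h f : l2 h -> l2 f -> real_form phi h f =
  4^-1 * \sum_(k < 4) 'i%C ^+ k * (spectral_int phi (pol f h k))%:C.
Proof.
move=> lh lf; rewrite /real_form /spectral_form; congr (_ * _); apply: eq_bigr => k _.
congr (_ * _); rewrite /spectral_integral /=; congr Complex.
by rewrite (integral_smeas m0 hP (l2_pol k lf lh)) integral0.
Qed.

Lemma real_form_lin a phi psi h f : L1 phi h -> L1 phi f -> L1 psi h -> L1 psi f ->
  real_form (fun l => a * phi l + psi l) h f = a%:C * real_form phi h f + real_form psi h f.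
Proof.
move=> p1 p2 q1 q2; have [lh _ _] := p1; have [lf _ _] := p2.
rewrite !real_formE// mulrCA -mulrDr; congr (_ * _).
rewrite mulr_sumr -big_split; apply: eq_bigr => k _ /=.
rewrite spectral_int_lin; try exact: L1_add.
by rewrite rmorphD rmorphM /=; ring.
Qed.

Lemma real_form_cvg (phi_ : nat -> R -> R) phi psi h f :
  (forall n, measurable_fun setT (phi_ n)) -> measurable_fun setT phi ->
  (forall l, phi_ n l @[n --> \oo] --> phi l) ->
  (forall n l, `|phi_ n l| <= psi l) -> L1 psi h -> L1 psi f ->
  cmod (real_form (phi_ n) h f - real_form phi h f) @[n --> \oo] --> (0 : R).
Proof.
move=> m_ mphi cphi le ph pf; have [lh _ _] := ph; have [lf _ _] := pf.
pose d k n := `|spectral_int (phi_ n) (pol f h k) - spectral_int phi (pol f h k)|.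
have dc k : d k n @[n --> \oo] --> (0 : R).
  have := spectral_int_cvg m_ mphi cphi le (L1_add ('i%C ^+ k) pf ph).
  by move=> /cvgrPdist_le H; apply/cvgr0Pnorm_le => e /H; apply: filterS => n;
    rewrite /d normr_id distrC.
apply: (@squeeze_cvgr _ _ _ _ (fun=> 0) (fun n => \sum_(k < 4) d k n)); last 2 first.
- exact: cvg_cst.
- rewrite -[X in _ --> X](@big1 R 0 +%R 'I_4 (index_enum _) xpredT (fun=> 0))//.
  by apply: cvg_big => [|k _]; [exact: add_continuous | exact: dc].
apply: nearW => n; rewrite cmod_ge0 /=.
rewrite !real_formE// -mulrBr -sumrB cmodM cmod_quarter.
apply: (le_trans (ler_piMl (cmod_ge0 _) _)); first by rewrite invf_le1 ?ler1n.
apply: le_trans (cmod_sum _ _) _; apply: ler_sum => k _.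
by rewrite -mulrBr -rmorphB cmodM cmod_iX mul1r cmodr.
Qed.

(** Meant for the Taylor remainder: a pointwise bound [psi] turns into four integrals of [psi],
    which are finite when [psi] is a power. *)
Lemma real_form_bound phi psi h f : measurable_fun setT phi -> (forall l, `|phi l| <= psi l) ->
  L1 psi h -> L1 psi f ->
  cmod (real_form phi h f) <= \sum_(k < 4) spectral_int psi (pol f h k).
Proof.
move=> mphi le ph pf; have [lh _ _] := ph; have [lf _ _] := pf.
have pv k : L1 phi (pol f h k) := L1_le mphi le (L1_add _ pf ph).
rewrite real_formE// cmodM cmod_quarter.
apply: (le_trans (ler_piMl (cmod_ge0 _) _)); first by rewrite invf_le1 ?ler1n.
apply: le_trans (cmod_sum _ _) _; apply: ler_sum => k _.
rewrite cmodM cmod_iX mul1r cmodr; apply: le_trans (spectral_int_abs (pv k)) _.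
exact: spectral_int_le (L1_norm (pv k)) (L1_add _ pf ph) le.
Qed.

End SpectralForm.

(** * Step functions of the operator and their limits *)

Section SimpleCalculus.
Context (R : realType) (X : countType) (m : X -> R) (m0 : forall x, 0 < m x).
Context (P : set R -> (X -> R[i]) -> X -> R[i]).
Implicit Types (f g h : X -> R[i]) (B : set R) (phi psi : R -> R).
Local Notation l2 := (l2 m).
Local Notation inner := (inner m).
Local Notation sqn := (sqnorm m).
Local Notation L1 := (L1 m P).
Local Notation sform := (real_form m P).
Local Notation sint := (spectral_int m P).
Context (hP : projection_valued_measure m P).

(* [simple phi S]: phi is a step function with a chosen representation, and S is
   the corresponding operator phi(L). *)
Inductive simple : (R -> R) -> ((X -> R[i]) -> X -> R[i]) -> Prop :=
| simple_nil : simple (fun=> 0) (fun _ _ => 0)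
| simple_cons c B phi S : measurable B -> simple phi S ->
    simple (fun l => c * \1_B l + phi l) (fun f x => c%:C * P B f x + S f x).

Lemma simple_l2 phi S f : simple phi S -> l2 f -> l2 (S f).
Proof.
move=> sS lf; elim: sS => [|c B {}phi {}S mB _ IH]; first exact: l2_0.
by apply: l2D => //; apply: l2Z => //; exact: (pvm_l2 hP).
Qed.

Lemma simple_meas phi S : simple phi S -> measurable_fun setT phi.
Proof.
elim=> [//|c B {}phi {}S mB _ IH]; apply: measurable_funD => //.
by apply: measurable_funM => //; exact: measurable_indic.
Qed.

Lemma simple_bounded phi S : simple phi S -> exists c, forall l, `|phi l| <= c.
Proof.
elim=> [|c B {}phi {}S mB _ [d IH]]; first by exists 0 => l; rewrite normr0.
exists (`|c| + d) => l; apply: le_trans (ler_normD _ _) _; apply: lerD => //.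
rewrite normrM ler_piMr// indicE; case: (_ \in _); rewrite ?normr1 ?normr0//.
Qed.

Lemma simple_L1 phi S f : simple phi S -> l2 f -> L1 phi f.
Proof.
move=> sS lf; have [c le] := simple_bounded sS.
exact: (L1_bounded m0 hP lf (simple_meas sS) le).
Qed.

Lemma simple_L1M phi S psi f : simple phi S -> L1 psi f -> L1 (fun l => phi l * psi l) f.
Proof.
move=> sS H; have [c le] := simple_bounded sS; have [lf mpsi If] := H.
apply: (@L1_le _ _ _ m0 _ hP _ (fun l => `|c * psi l|)).
- by apply: measurable_funM => //; exact: simple_meas sS.
- move=> l; rewrite !normrM ler_wpM2r//; apply: le_trans (le l) (ler_norm _).
- exact/(L1_norm m0 hP)/L1_scale.
Qed.

(** Against the spectral measure of u the indicator integrates to <u, P(B) u>, so this is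
    polarization of the sesquilinear form <u, P(B) v>. *)
Lemma real_form_indic B h f : measurable B -> l2 h -> l2 f ->
  sform \1_B h f = inner h (P B f).
Proof.
move=> mB lh lf; rewrite (real_formE m0 hP)//.
have lPf := pvm_l2 hP mB lf; have lPh := pvm_l2 hP mB lh.
rewrite (eq_bigr (fun k : 'I_4 => 'i%C ^+ k * (inner f (P B f) +
    'i%C ^+ k * inner f (P B h) + ('i%C ^+ k)^* * inner h (P B f) +
    ('i%C ^+ k)^* * 'i%C ^+ k * inner h (P B h)))); last first.
  move=> k _; congr (_ * _); have lv := l2_pol m0 k lf lh.
  rewrite (spectral_int_indic m0 hP)// -(pvm_sqnorm hP)// (pvmD hP)//; last exact: l2Z.
  rewrite (pvmZ m0 hP)// innerDr//; last exact: l2Z.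
  rewrite !innerZr// !innerDl// ?innerZl//; try exact: l2Z.
  by ring.
exact: polarization.
Qed.

Lemma real_form_simple phi S h f : simple phi S -> l2 h -> l2 f ->
  sform phi h f = inner h (S f).
Proof.
move=> sS lh lf; elim: sS => [|c B {}phi {}S mB sS IH].
  rewrite inner0r (real_formE m0 hP)// big1 ?mulr0// => k _.
  by rewrite /spectral_int (integral_smeas m0 hP (l2_pol m0 k lf lh)) integral0 mulr0.
rewrite (real_form_lin m0 hP); try exact: L1_indic; try exact: simple_L1 sS _.
have lPf := pvm_l2 hP mB lf; have lS := simple_l2 sS lf.
rewrite innerDr// ?innerZr//; last exact: l2Z.
by rewrite real_form_indic// IH.
Qed.

Lemma simple1 B : measurable B -> simple \1_B (P B).
Proof.
move=> mB; have := simple_cons 1 mB simple_nil.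
under eq_fun do rewrite mul1r addr0.
rewrite (_ : (fun f x => _) = P B)//.
by apply/funext => f; apply/funext => x; rewrite mul1r addr0.
Qed.

Lemma real_form_indicM B psi T f g : measurable B -> simple psi T -> l2 f -> l2 g ->
  inner (P B f) (T g) = sform (fun l => \1_B l * psi l) f g.
Proof.
move=> mB sT lf lg; have lPf := pvm_l2 hP mB lf.
elim: sT => [|c B' {}psi {}T mB' sT IH].
  rewrite inner0r; under eq_fun do rewrite mulr0.
  by rewrite (real_form_simple simple_nil lf lg) inner0r.
have mBB := measurableI _ _ mB mB'.
rewrite (_ : (fun l => _) = (fun l => c * \1_(B `&` B') l + \1_B l * psi l)); last first.
  by apply/funext => l; rewrite indicI /=; ring.
have LT : forall v, l2 v -> L1 (fun l => \1_B l * psi l) v.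
  by move=> v lv; apply: simple_L1M (simple1 mB) _; exact: simple_L1 sT lv.
rewrite (real_form_lin m0 hP) ?real_form_indic//; try exact: L1_indic; try exact: LT.
have lPg := pvm_l2 hP mB' lg; have lT := simple_l2 sT lg.
by rewrite innerDr// ?innerZr// ?IH ?(pvm_inner hP)//; exact: l2Z.
Qed.

(** Multiplicativity of the calculus in weak form, by induction on both step functions. The base is
    P(B) P(B') = P(B [&] B'), matching the product of the indicators; the case of one indicator on
    the left is [real_form_indicM]. *)
Lemma real_form_simpleM phi psi S T f g : simple phi S -> simple psi T -> l2 f -> l2 g ->
  inner (S f) (T g) = sform (fun l => phi l * psi l) f g.
Proof.
move=> sS sT lf lg; have lT := simple_l2 sT lg.
elim: sS => [|c B {}phi {}S mB sS IH].
  rewrite inner0l//; under eq_fun do rewrite mul0r.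
  by rewrite (real_form_simple simple_nil lf lg) inner0r.
rewrite (_ : (fun l => _ * _) = (fun l => c * (\1_B l * psi l) + phi l * psi l)); last first.
  by apply/funext => l; ring.
have LT phi' S' v : simple phi' S' -> l2 v -> L1 (fun l => phi' l * psi l) v.
  by move=> sS' lv; apply: simple_L1M sS' _; exact: simple_L1 sT lv.
rewrite (real_form_lin m0 hP); try exact: LT sS _; try exact: LT (simple1 mB) _.
have lPf := pvm_l2 hP mB lf; have lS := simple_l2 sS lf.
rewrite innerDl//; last exact: l2Z.
by rewrite innerZl// conj_real IH (real_form_indicM mB sT lf lg).
Qed.

Lemma simple_lin a phi psi S T : simple phi S -> simple psi T ->
  simple (fun l => a * phi l + psi l) (fun f x => a%:C * S f x + T f x).
Proof.
move=> sS sT; elim: sS => [|c B {}phi {}S mB sS IH].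
  under eq_fun do rewrite mulr0 add0r.
  rewrite (_ : (fun f x => _) = T)//.
  by apply/funext => f; apply/funext => x; rewrite mulr0 add0r.
have := simple_cons (a * c) mB IH; congr simple.
  by apply/funext => l; ring.
by apply/funext => f; apply/funext => x; rewrite rmorphM /=; ring.
Qed.

Lemma simple_nnsfun (phi : {nnsfun R >-> R}) : exists S, simple phi S.
Proof.
(* Replacing the finite range by a list makes the sum accessible to the induction that builds
   [simple]. *)
have [s E] : exists s : seq R,
    (phi : R -> R) = (fun l => \sum_(y <- s) y * \1_(phi @^-1` [set y]) l).
  by eexists; apply/funext => l; rewrite fimfunE fsbig_finite.
rewrite {}E; elim: s => [|y s [S IH]].
  by exists (fun _ _ => 0); under eq_fun do rewrite big_nil; exact: simple_nil.
exists (fun f x => y%:C * P (phi @^-1` [set y]) f x + S f x).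
under eq_fun do rewrite big_cons; apply: simple_cons IH.
exact: measurable_funPTI.
Qed.

(** Positive and negative parts are approximated from below, hence |phi_n| is at most their sum
    |phi|. So [phi] itself serves as the dominating function later. *)
Lemma simple_approx phi : measurable_fun setT phi ->
  exists (phi_ : nat -> R -> R) (S_ : nat -> (X -> R[i]) -> X -> R[i]),
  [/\ forall n, simple (phi_ n) (S_ n),
    forall l, phi_ n l @[n --> \oo] --> phi l &
    forall n l, `|phi_ n l| <= `|phi l|].
Proof.
move=> mphi.
have mE psi : measurable_fun setT psi -> measurable_fun setT (EFin \o psi).
  by move=> mpsi; exact/measurable_EFinP.
have A psi : measurable_fun setT psi -> (forall l, 0 <= psi l) ->
    exists (psi_ : nat -> R -> R) (S_ : nat -> (X -> R[i]) -> X -> R[i]),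
    [/\ forall n, simple (psi_ n) (S_ n),
    forall l, psi_ n l @[n --> \oo] --> psi l &
    forall n l, 0 <= psi_ n l <= psi l].
  move=> mpsi psi0; pose g := nnsfun_approx measurableT (mE _ mpsi).
  have [S_ HS] := choice (fun n => simple_nnsfun (g n)).
  have cg l : g n l @[n --> \oo] --> psi l.
    have psiE0 l' : [set: R] l' -> (0 <= (EFin \o psi) l')%E by rewrite /= lee_fin.
    by have /fine_cvg := cvg_nnsfun_approx measurableT (mE _ mpsi) psiE0 (I : [set: R] l).
  exists (fun n => g n : R -> R), S_; split => // n l.
  apply/andP; split => //.
  have nd : {homo (fun n => g n l) : x y / (x <= y)%N >-> x <= y}.
    by move=> a b ab; have /lefP := nd_nnsfun_approx measurableT (mE _ mpsi) ab; exact.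
  by apply: le_trans (nondecreasing_cvgn_le nd (cvgP _ (cg l)) n) _; rewrite (cvg_lim _ (cg l)).
have [p [S [sS cp lp]]] := A _ (measurable_funrpos mphi) (funrpos_ge0 phi).
have [q [T [sT cq lq]]] := A _ (measurable_funrneg mphi) (funrneg_ge0 phi).
exists (fun n l => -1 * q n l + p n l), (fun n f x => (-1)%:C * T n f x + S n f x).
split=> [n|l|n l].
- exact: simple_lin.
- have -> : phi l = -1 * phi^\- l + phi^\+ l.
    by rewrite mulN1r addrC -[in LHS](funrposBneg phi).
  by apply: cvgD => //; apply: cvgMr.
- have /andP[p0 p1] := lp n l; have /andP[q0 q1] := lq n l.
  rewrite mulN1r addrC; apply: le_trans (ler_normB _ _) _.
  rewrite (ger0_norm p0) (ger0_norm q0).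
  apply: le_trans (lerD p1 q1) _.
  by have /(congr1 (fun F => F l)) := funrposDneg phi; rewrite fctE /= => ->.
Qed.

(** For step functions both sides are <f, phi(L) f>; dominated convergence gives the general
    case. *)
Lemma real_form_diag phi f : L1 phi f -> sform phi f f = (sint phi f)%:C.
Proof.
move=> H; have [lf mphi _] := H; have [phi_ [S_ [sS cphi le]]] := simple_approx mphi.
have E psi S : simple psi S -> sform psi f f = (sint psi f)%:C.
  move=> sT; rewrite (real_form_simple sT)//; elim: sT => [|c B {}psi {}S' mB sT IH].
    by rewrite inner0r /spectral_int (integral_smeas m0 hP lf) integral0.
  have lPf := pvm_l2 hP mB lf; have lS := simple_l2 sT lf.
  rewrite innerDr// ?innerZr// ?IH; try exact: l2Z.
  rewrite (spectral_int_lin m0 hP); [|exact: L1_indic|exact: simple_L1 sT lf].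
  by rewrite (spectral_int_indic m0 hP)// (pvm_sqnorm hP)// -rmorphM -rmorphD.
have H1 := L1_norm m0 hP H.
have m_ n := simple_meas (sS n).
apply: (cmod_cvg_unique (real_form_cvg m0 hP m_ mphi cphi le H1 H1)).
under eq_cvg do rewrite (E _ _ (sS _)) -rmorphB cmodr.
have /cvgrPdist_le C := spectral_int_cvg m0 hP m_ mphi cphi le H1.
by apply/cvgr0Pnorm_le => e /C; apply: filterS => n; rewrite normr_id distrC.
Qed.

(** The isometry that turns convergence of integrals into convergence of vectors. *)
Lemma simple_sqnorm phi S f : simple phi S -> l2 f ->
  sqn (S f) = sint (fun l => phi l * phi l) f.
Proof.
move=> sS lf; apply: complexI; have lS := simple_l2 sS lf.
rewrite -inner_sqnorm// (real_form_simpleM sS sS)// real_form_diag//.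
exact: simple_L1M sS (simple_L1 sS lf).
Qed.

(** Membership of f in the domain of phi(L) for real measurable [phi]; see [L2P]. *)
Definition L2 phi f := [/\ l2 f, measurable_fun setT phi & L1 (fun l => phi l * phi l) f].

(** The spectral measure of f is finite, and |phi| <= phi^2 + 1. *)
Lemma L2_L1 phi f : L2 phi f -> L1 phi f.
Proof.
move=> [lf mphi H]; apply: (L1_le m0 hP mphi _ (L1_lin m0 hP 1 H (L1_cst m0 hP 1 lf))).
by move=> l; have := sqr_ge0 (`|phi l| - 1); have := real_normK (num_real (phi l)); nra.
Qed.

Lemma L2_L1M phi psi f : L2 phi f -> L2 psi f -> L1 (fun l => `|phi l * psi l|) f.
Proof.
move=> [lf mphi H] [_ mpsi K]; apply: (L1_le m0 hP _ _ (L1_lin m0 hP 1 H K)).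
  by apply: measurableT_comp => //; exact: measurable_funM.
move=> l; rewrite normr_id ler_norml; have := sqr_ge0 (phi l - psi l).
by have := sqr_ge0 (phi l + psi l); nra.
Qed.

Definition approximates (phi_ : nat -> R -> R) (S_ : nat -> (X -> R[i]) -> X -> R[i]) phi :=
  [/\ forall n, simple (phi_ n) (S_ n),
    forall l, phi_ n l @[n --> \oo] --> phi l &
    forall n l, `|phi_ n l| <= `|phi l|].

(* The S_n f form a Cauchy sequence, since the square of the distance of S_i f and
   S_j f is the integral of (phi_i - phi_j)^2 against the spectral measure of f;
   the limit is phi(L) f. *)
Lemma fcalc_lim phi f (phi_ : nat -> R -> R) S_ : L2 phi f -> approximates phi_ S_ phi ->
  exists2 g, l2 g /\ (forall h, L1 phi h -> inner h g = sform phi h f) &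
  exists2 c : nat -> R, c @ \oo --> (0 : R) & forall n, sqn (fun x => S_ n f x - g x) <= c n.
Proof.
move=> Hphi [sS cphi le]; have [lf mphi H2] := Hphi.
have m_ n := simple_meas (sS n).
(* The factor 2 comes from (a - b)^2 <= 2 (a - p)^2 + 2 (b - p)^2, with a, b, p the values of phi_i,
   phi_j and phi. *)
pose c n := 2 * sint (fun l => (phi_ n l - phi l) * (phi_ n l - phi l)) f.
(* The dominating function 4 phi^2, from |phi_n - phi| <= 2 |phi|. *)
have L4 := L1_scale m0 hP 4 H2.
have mm n : measurable_fun setT (fun l => (phi_ n l - phi l) * (phi_ n l - phi l)).
  by apply: measurable_funM; apply: measurable_funB.
have dom n l : `|(phi_ n l - phi l) * (phi_ n l - phi l)| <= 4 * (phi l * phi l).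
  have A := le n l; have N := real_normK (num_real (phi l)).
  have T := ler_normB (phi_ n l) (phi l); rewrite normrM.
  have Z := normr_ge0 (phi_ n l - phi l); have Z' := normr_ge0 (phi l).
  rewrite -[phi l * phi l]expr2 -N; move: Z Z' T A.
  by move: (`|_|) (`|phi l|) (`|_|) => p q r; nra.
have L_ n : L1 (fun l => (phi_ n l - phi l) * (phi_ n l - phi l)) f.
  exact: (L1_le m0 hP (mm n) (dom n) L4).
have c0 : c @ \oo --> (0 : R).
  rewrite -[X in _ --> X](mulr0 2); apply: cvgMr.
  rewrite -[X in _ --> X](_ : sint (fun=> 0) f = 0); last first.
    by rewrite /spectral_int (integral_smeas m0 hP lf) integral0.
  apply: (spectral_int_cvg m0 hP mm _ _ dom L4) => // l.
  rewrite -[X in _ --> X](mul0r 0); apply: cvgM; rewrite -[X in _ --> X](subrr (phi l));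
    by apply: cvgB => //; exact: cvg_cst.
have lS n : l2 (S_ n f) by exact: simple_l2 (sS n) lf.
have cauchy i j : sqn (fun x => S_ i f x - S_ j f x) <= c i + c j.
  have := simple_sqnorm (simple_lin (-1) (sS j) (sS i)) lf.
  rewrite (_ : (fun x => _) = (fun x => S_ i f x - S_ j f x)); last first.
    by apply/funext => x; rewrite rmorphN1 mulN1r addrC.
  move=> ->; rewrite /c -!(spectral_int_scale m0 hP)// -(spectral_int_add m0 hP) //; try exact: L1_scale.
  apply: (spectral_int_le m0 hP); last first.
  - by move=> l; have := sqr_ge0 (phi_ i l + phi_ j l - 2 * phi l); nra.
  - by have := L1_lin m0 hP 1 (L1_scale m0 hP 2 (L_ i)) (L1_scale m0 hP 2 (L_ j));
      under eq_fun do rewrite mul1r.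
  - by apply: simple_L1M (simple_L1 _ lf); exact: simple_lin.
have [g [lg gc]] := l2_complete m0 lS c0 cauchy.
exists g; last by exists c.
split => // h ph; have [lh _ _] := ph.
have p1 := L1_norm m0 hP ph; have p2 := L1_norm m0 hP (L2_L1 Hphi).
apply: (cmod_cvg_unique _ (real_form_cvg m0 hP m_ mphi cphi le p1 p2)).
under eq_cvg do rewrite (real_form_simple (sS _) lh lf).
apply: (inner_cvg m0 (c := fun=> 0) (d := c)) => //; first exact: cvg_cst.
(* The first argument is the constant sequence h; that h - h has norm 0 is read off from scaling h
   by 0. *)
move=> _; have := sqnormZ m0 0 lh; rewrite cmod0 expr0n mul0r => <-.
by rewrite le_eqVlt; apply/orP; left; apply/eqP; congr sqnorm; apply/funext => x; rewrite subrr mul0r.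
Qed.

End SimpleCalculus.

(** * Identification of the values of [fcalc] *)

Section FunctionalCalculus.
Context (R : realType) (X : countType) (m : X -> R) (m0 : forall x, 0 < m x).
Context (P : set R -> (X -> R[i]) -> X -> R[i]).
Implicit Types (f g h : X -> R[i]) (B : set R) (phi psi : R -> R).
Local Notation l2 := (l2 m).
Local Notation inner := (inner m).
Local Notation sqn := (sqnorm m).
Local Notation L1 := (L1 m P).
Local Notation L2 := (L2 m P).
Local Notation sform := (real_form m P).
Context (hP : projection_valued_measure m P).

Lemma L2P phi f : measurable_fun setT phi ->
  fcalc_dom m P (fun l => (phi l)%:C) f <-> L2 phi f.
Proof.
move=> mphi.
have mpp : measurable_fun setT (fun l => phi l * phi l) by exact: measurable_funM.
have E : (fun l : R => (cmod (phi l)%:C ^+ 2)%:E) = (fun l => (`|phi l * phi l|)%:E).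
  by apply/funext => l; rewrite cmodr -normrX expr2.
by split=> [[lf]|[lf _ [_ _]]]; rewrite ?E => H; do ?split => //; rewrite E.
Qed.

Lemma L2_bounded phi (c : R) f : l2 f -> measurable_fun setT phi ->
  (forall l, `|phi l| <= c) -> L2 phi f.
Proof.
move=> lf mphi le; split => //; apply: (@L1_bounded _ _ _ m0 _ hP _ (c * c)) => //.
  exact: measurable_funM.
by move=> l; rewrite normrM ler_pM.
Qed.

(** [fcalc_lim] supplies a vector meeting the condition in [fcalc], so [xget] does not fall back to
    0. The vector is unique because all [delta x] are in the domain and testing against them reads
    off its coordinates; hence every approximating sequence converges to it. *)
Lemma fcalc_spec phi f : measurable_fun setT phi -> (forall x, L2 phi (delta R x)) -> L2 phi f ->
  [/\ l2 (fcalc m P (fun l => (phi l)%:C) f),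
   (forall h, L1 phi h -> inner h (fcalc m P (fun l => (phi l)%:C) f) = sform phi h f) &
   forall (phi_ : nat -> R -> R) S_, approximates P phi_ S_ phi ->
   exists2 c : nat -> R, c @ \oo --> (0 : R) &
     forall n, sqn (fun x => S_ n f x - fcalc m P (fun l => (phi l)%:C) f x) <= c n].
Proof.
move=> mphi pd pf; set g := fcalc m P _ f.
have [phi_ [S_ H]] := simple_approx P mphi.
have [g0 [lg0 g0E] _] := fcalc_lim m0 hP pf H.
have graph : fcalc_graph m P (fun l => (phi l)%:C) f g.
  apply: (@xgetPex _ (fun=> 0) [set g | fcalc_graph m P (fun l => (phi l)%:C) f g]).
  exists g0; split => //; first exact/L2P.
  by move=> h /(L2P _ mphi) ph; apply: g0E; exact: (L2_L1 m0 hP).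
have [_ lg gE] := graph.
have uniq g' : l2 g' -> (forall h, L1 phi h -> inner h g' = sform phi h f) -> g' = g.
  move=> lg' g'E; apply: (inner_delta_inj m0) => x.
  rewrite gE; last exact/L2P.
  by apply: g'E; exact: (L2_L1 m0 hP).
rewrite -(uniq _ lg0 g0E); split => // psi_ T_ K.
by have [g1 [lg1 g1E]] := fcalc_lim m0 hP pf K; rewrite (uniq _ lg1 g1E) (uniq _ lg0 g0E).
Qed.

(** The limit of [real_form_simpleM], dominated by |phi psi|, which is integrable as a product of
    square integrable functions. *)
Lemma fcalc_inner phi psi f g : (forall x, L2 phi (delta R x)) ->
  (forall x, L2 psi (delta R x)) -> L2 phi f -> L2 psi f -> L2 phi g -> L2 psi g ->
  inner (fcalc m P (fun l => (phi l)%:C) f) (fcalc m P (fun l => (psi l)%:C) g) =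
  sform (fun l => phi l * psi l) f g.
Proof.
move=> pd qd pf qf pg qg.
have [lf mphi _] := pf; have [lg mpsi _] := qg.
have [phi_ [S_ A]] := simple_approx P mphi.
have [psi_ [T_ B]] := simple_approx P mpsi.
have [lF _ /(_ _ _ A) [c c0 Hc]] := fcalc_spec mphi pd pf.
have [lG _ /(_ _ _ B) [d d0 Hd]] := fcalc_spec mpsi qd qg.
have [sS cphi lephi] := A; have [sT cpsi lepsi] := B.
have lS n : l2 (S_ n f) := simple_l2 m0 hP (sS n) lf.
have lT n : l2 (T_ n g) := simple_l2 m0 hP (sT n) lg.
apply: (cmod_cvg_unique (inner_cvg m0 lS lT lF lG c0 d0 Hc Hd)).
under eq_cvg do rewrite (real_form_simpleM m0 hP (sS _) (sT _) lf lg).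
apply: (real_form_cvg m0 hP _ _ _ _ (L2_L1M m0 hP pf qf) (L2_L1M m0 hP pg qg)).
- by move=> n; apply: measurable_funM; [exact: simple_meas (sS n)|exact: simple_meas (sT n)].
- exact: measurable_funM.
- by move=> l; apply: cvgM.
- by move=> n l; rewrite !normrM ler_pM.
Qed.

Lemma spectral_form_complex (a b : R -> R) h f : l2 h -> l2 f ->
  spectral_form m P (fun l => a l +i* b l) h f = sform a h f + 'i%C * sform b h f.
Proof.
move=> lh lf; rewrite !(real_formE m0 hP)// mulrCA -mulrDr; congr (_ * _).
rewrite mulr_sumr -big_split; apply: eq_bigr => k _ /=.
rewrite mulrCA -mulrDr; congr (_ * _); rewrite /spectral_integral /=.
by apply/eqP; rewrite eq_complex /= !mulr0 !mul0r !mul1r subr0 addr0 !add0r ?addr0 !eqxx.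
Qed.

(** Since a(L) and b(L) are defined on all of [l2], the vector a(L) f + i b(L) f is an admissible
    value. Whichever value [xget] selects, its product with [delta R x] is prescribed by the
    form. *)
Lemma fcalc_complex (a b : R -> R) f x :
  (forall f, l2 f -> L2 a f) -> (forall f, l2 f -> L2 b f) -> l2 f ->
  inner (delta R x) (fcalc m P (fun l => a l +i* b l) f) =
  sform a (delta R x) f + 'i%C * sform b (delta R x) f.
Proof.
move=> La Lb lf; have [_ ma _] := La _ lf; have [_ mb _] := Lb _ lf.
have dom h : l2 h -> fcalc_dom m P (fun l => a l +i* b l) h.
  move=> lh; split => //; have [_ _ Ha] := La _ lh; have [_ _ Hb] := Lb _ lh.
  (* |a + i b|^2 = a^2 + b^2, whose integrability is that of the sum of [Ha] and [Hb]. *)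
  have [_ mm] := L1_lin m0 hP 1 Ha Hb; congr (_ < _)%E.
  rewrite (integral_smeas m0 hP lh) (integral_smeas m0 hP lh); apply: eq_integral => l _.
  rewrite cmod_sq /= mul1r -!expr2 ger0_norm//.
  by rewrite addr_ge0 ?sqr_ge0.
set g := fcalc m P _ f.
have graph : fcalc_graph m P (fun l => a l +i* b l) f g.
  apply: (@xgetPex _ (fun=> 0) [set g | fcalc_graph m P (fun l => a l +i* b l) f g]).
  have [a_ [S_ A]] := simple_approx P ma.
  have [b_ [T_ B]] := simple_approx P mb.
  have [ga [lga gaE] _] := fcalc_lim m0 hP (La _ lf) A.
  have [gb [lgb gbE] _] := fcalc_lim m0 hP (Lb _ lf) B.
  exists (fun x => ga x + 'i%C * gb x); split; first exact: dom.
    by apply: l2D => //; exact: l2Z.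
  move=> h [lh _]; rewrite spectral_form_complex// innerDr// ?innerZr//; last exact: l2Z.
  by rewrite gaE ?gbE//; apply: (L2_L1 m0 hP); first [exact: La | exact: Lb].
have [_ _ ->] := graph; first by rewrite spectral_form_complex//; exact: l2_delta.
exact/dom/l2_delta.
Qed.

End FunctionalCalculus.

(** * The spectral measures live on the nonnegative half-line *)

Section Positivity.
Context (R : realType) (X : countType) (m : X -> R) (m0 : forall x, 0 < m x).
Context (P : set R -> (X -> R[i]) -> X -> R[i]).
Implicit Types (f g h : X -> R[i]) (B : set R) (phi psi : R -> R).
Local Notation l2 := (l2 m).
Local Notation sqn := (sqnorm m).
Local Notation L1 := (L1 m P).
Local Notation L2 := (L2 m P).
Local Notation sform := (real_form m P).
Local Notation sint := (spectral_int m P).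
Context (hP : projection_valued_measure m P).

Section AlmostEverywhere.
Context (N : set R) (mN : measurable N) (f : X -> R[i]) (lf : l2 f).
Context (N0 : sqn (P N f) = 0).

Let aeN (phi psi : R -> R) : (forall l, ~ N l -> phi l = psi l) ->
  ae_eq (smeas m0 hP lf) setT (EFin \o phi) (EFin \o psi).
Proof.
move=> E; exists N; split => //; first by rewrite [LHS](smeas_sqnorm m0 hP lf mN) N0.
by move=> l /= H; apply: contrapT => Nl; apply: H => _; rewrite E.
Qed.

Lemma spectral_int_ae phi psi : measurable_fun setT phi -> measurable_fun setT psi ->
  (forall l, ~ N l -> phi l = psi l) -> sint phi f = sint psi f.
Proof.
move=> mphi mpsi E; rewrite !(spectral_intE m0 hP _ lf) /Rintegral; congr fine.
by apply: ae_eq_integral; [exact: measurableT|exact/measurable_EFinP..|exact: aeN].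
Qed.

Lemma L1_ae phi psi : measurable_fun setT phi -> (forall l, ~ N l -> phi l = psi l) ->
  L1 psi f -> L1 phi f.
Proof.
move=> mphi E [_ mpsi Ipsi]; split => //; apply: le_lt_trans Ipsi.
rewrite !(integral_smeas m0 hP lf) le_eqVlt; apply/orP; left; apply/eqP.
apply: ae_eq_integral; [exact: measurableT|by apply/measurable_EFinP; exact: measurableT_comp..|].
by apply: (aeN (phi := fun l => `|phi l|)) => l /E ->.
Qed.

Lemma L2_ae phi psi : measurable_fun setT phi -> (forall l, ~ N l -> phi l = psi l) ->
  L2 psi f -> L2 phi f.
Proof.
move=> mphi E [_ mpsi H]; split => //; apply: L1_ae H; first exact: measurable_funM.
by move=> l /E ->.
Qed.

End AlmostEverywhere.

Lemma pvm_disjoint A B f : measurable A -> measurable B -> A `&` B = set0 -> l2 f ->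
  sqn (P A (P B f)) = 0.
Proof.
move=> mA mB AB lf; rewrite -(pvmI hP)// AB (pvm0 hP)// /sqnorm.
by under eq_fun do rewrite cmod0 expr0n mul0r; rewrite rsum0.
Qed.

Context (L : operator R X) (specL : spectral_resolution m P L)
  (L0 : nonneg_operator m L).

(* Test the nonnegativity of L on f' = P([a, b]) f: there <f', L f'> <= b |f'|^2. *)
Let bounded_negative (a b : R) f : b < 0 -> l2 f -> sqn (P `[a, b] f) = 0.
Proof.
move=> b0 lf; set A := `[a, b]%classic; have mA : measurable A by exact: measurable_itv.
set f' := P A f; have lf' : l2 f' by exact: pvm_l2.
have mAC : measurable (~` A) by exact: measurableC.
have N0 : sqn (P (~` A) f') = 0 by exact: (pvm_disjoint mAC mA (setICl A) lf).
(* The identity cut off to A is bounded and differs from the identity only on a null set for f'.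
   This puts f' in the domain of L and bounds <f', L f'>. *)
pose psi (l : R) := l * \1_A l.
have mpsi : measurable_fun setT psi by apply: measurable_funM => //; exact: measurable_indic.
have E l : ~ (~` A) l -> l = psi l.
  by move=> /contrapT Al; rewrite /psi indicE mem_set// mulr1.
have psib l : `|psi l| <= `|a| + `|b|.
  rewrite /psi indicE; have [/set_mem|_] := boolP (l \in A); last by rewrite mulr0 normr0 addr_ge0.
  rewrite /A /= in_itv /= mulr1 => /andP[al lb].
  by have := ler_norm b; have := ler_norm (- a); have := normr_ge0 a;
    have := normr_ge0 b; rewrite normrN; case: (ger0P l); lra.
have Lid : L2 id f'.
  apply: (L2_ae mAC lf' N0 _ E) => //; exact: L2_bounded psib.
have [phi_ [S_ H]] := simple_approx P (@measurable_id _ R setT).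
have [g [lg gE] _] := fcalc_lim m0 hP Lid H.
have graph : fcalc_graph m P (fun l => l%:C) f' g.
  have D h : fcalc_dom m P (fun l => l%:C) h <-> L2 id h by exact: L2P.
  by split; [exact/D| |move=> h /D ph; apply: gE; exact: (L2_L1 m0 hP)].
have [domf Lf] := (specL.2 f' g).1 graph.
have := L0 domf; rewrite Lf gE; last exact: (L2_L1 m0 hP).
rewrite (real_form_diag m0 hP); last exact: (L2_L1 m0 hP).
rewrite ler0c (spectral_int_ae mAC lf' N0 _ mpsi E)// => ge0.
have Lpsi : L1 psi f' by exact: (L1_bounded m0 hP lf' mpsi psib).
have Lb := L1_scale m0 hP b (L1_indic m0 hP mA lf').
have := spectral_int_le m0 hP Lpsi Lb.
rewrite (spectral_int_scale m0 hP); last exact: L1_indic.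
rewrite (spectral_int_indic m0 hP)// (_ : P A f' = f'); last by rewrite /f' -(pvmI hP)// setIid.
move=> /(_ _)/(le_trans ge0) H1.
have : 0 <= b * sqn f'.
  apply: H1 => l; rewrite /psi indicE; have [/set_mem|_] := boolP (l \in A); last by rewrite !mulr0.
  by rewrite /A /= in_itv /= !mulr1 => /andP[].
have := sqnorm_ge0 m0 f'; rewrite le_eqVlt => /predU1P[->//|f0].
by rewrite nmulr_rge0// leNgt f0.
Qed.

(** The negative half-line is a countable union of compact intervals staying away from 0, each null
    by [bounded_negative]. *)
Lemma spectrum_ge0 f : l2 f -> sqn (P `]-oo, 0[ f) = 0.
Proof.
move=> lf; apply: EFin_inj; rewrite -(smeas_sqnorm m0 hP lf)//.
apply: measure_negligible => //.
have -> : `]-oo, 0[%classic = \bigcup_n `[- n.+1%:R, - n.+1%:R^-1]%classic :> set R.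
  apply/seteqP; split => [x|x [n _]] /=; rewrite !in_itv /=.
    move=> x0; pose n := maxn (Num.truncn (- x)) (Num.truncn (- x)^-1).
    have h1 : - x < n.+1%:R by rewrite (lt_le_trans (truncnS_gt _))// ler_nat ltnS leq_maxl.
    have h2 : (- x)^-1 < n.+1%:R by rewrite (lt_le_trans (truncnS_gt _))// ler_nat ltnS leq_maxr.
    exists n => //; rewrite /= in_itv /=; apply/andP; split; first by lra.
    rewrite lerNr -[leRHS]invrK lef_pV2 ?posrE ?invr_gt0 ?oppr_gt0//; exact: ltW.
  by move=> /andP[_ /le_lt_trans]; apply; rewrite oppr_lt0 invr_gt0.
apply: negligible_bigcup => n; apply/negligibleP => //.
rewrite [LHS](smeas_sqnorm m0 hP lf)// bounded_negative//.
Qed.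

(** Permits replacing a function at will on the negative half-line, for instance by a cut-off. *)
Lemma real_form_nneg phi psi h f : measurable_fun setT phi -> measurable_fun setT psi ->
  l2 h -> l2 f -> (forall l, 0 <= l -> phi l = psi l) -> sform phi h f = sform psi h f.
Proof.
move=> mphi mpsi lh lf E; rewrite !(real_formE m0 hP)//.
congr (_ * _); apply: eq_bigr => k _; congr (_ * (_)%:C).
have lv := l2_pol m0 k lf lh.
apply: (spectral_int_ae _ lv (spectrum_ge0 lv)) => // l /=; rewrite in_itv /= => /negP.
by rewrite -leNgt; exact: E.
Qed.

Lemma L2_nneg phi psi f : measurable_fun setT phi ->
  (forall l, 0 <= l -> phi l = psi l) -> L2 psi f -> L2 phi f.
Proof.
move=> mphi E H; have [lf _ _] := H.
apply: (L2_ae _ lf (spectrum_ge0 lf) mphi _ H) => // l /=; rewrite in_itv /= => /negP.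
by rewrite -leNgt; exact: E.
Qed.

End Positivity.

(** * Matrix coefficients of powers of L and the graph distance *)

Section Moments.
Context (R : realType) (X : countType) (m : X -> R) (m0 : forall x, 0 < m x).
Context (P : set R -> (X -> R[i]) -> X -> R[i]).
Context (E : rel X) (graphE : combinatorial_graph E).
Context (L : operator R X) (specL : spectral_resolution m P L)
  (lapL : laplacian_on_graph m P E L)
  (Cc_powL : forall n : nat, @Cc R X `<=` opdom (op_pow m P n)).
Local Notation sform := (real_form m P).
Local Notation L2 := (L2 m P).
Local Notation delta := (delta R).
Let hP : projection_valued_measure m P := specL.1.
Let L0 : nonneg_operator m L.
Proof. by case: lapL. Qed.

Lemma Cc_delta x : @Cc R X (delta x).
Proof.
apply: (@sub_finite_set _ _ [set x]) => // z; apply: contraPP => /= /eqP /negbTE zx.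
by rewrite /Defs.delta zx /= => /negP; apply.
Qed.

Lemma measurable_pow n : measurable_fun setT (fun l : R => l ^+ n).
Proof. exact: measurable_funX. Qed.

Lemma L2_pow n x : L2 (fun l => l ^+ n) (delta x).
Proof. by apply/(L2P _ _ _ (measurable_pow n)); exact/Cc_powL/Cc_delta. Qed.

(** The number <1_x, L^k 1_y>; [op_pow_delta] relates it to the values of [op_pow]. *)
Definition moment k x y := sform (fun l => l ^+ k) (delta x) (delta y).

Lemma op_pow_delta k x y : op_pow m P k (delta y) x = moment k x y / (m x)%:C.
Proof.
have [_ H _] := fcalc_spec m0 hP (measurable_pow k) (L2_pow k) (L2_pow k y).
rewrite /moment -H; last exact/(L2_L1 m0 hP)/L2_pow.
rewrite inner_delta mulfK// -[0]/(0%:C) (inj_eq (@complexI R)).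
by rewrite gt_eqF.
Qed.

(** l^0 is the indicator of the whole line, and P of the whole line is the identity. *)
Lemma moment0 x y : moment 0 x y = delta y x * (m x)%:C.
Proof.
rewrite /moment -inner_delta -[in RHS](pvmT hP (l2_delta m0 y)).
rewrite -(real_form_indic m0 hP measurableT (l2_delta m0 x) (l2_delta m0 y)).
by congr real_form; apply/funext => l; rewrite expr0 indicT.
Qed.

(* Since z |-> moment k z y / m z is L^k 1_y, the right-hand side is <L 1_x, L^k 1_y>. *)
Lemma momentS k x y : csummable (fun z => (moment 1 z x)^* * moment k z y / (m z)%:C) /\
  moment k.+1 x y = csum (fun z => (moment 1 z x)^* * moment k z y / (m z)%:C).
Proof.
have H := fcalc_inner m0 hP (L2_pow 1) (L2_pow k) (L2_pow 1 x) (L2_pow k x)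
  (L2_pow 1 y) (L2_pow k y).
have [l1 _ _] := fcalc_spec m0 hP (measurable_pow 1) (L2_pow 1) (L2_pow 1 x).
have [l2' _ _] := fcalc_spec m0 hP (measurable_pow k) (L2_pow k) (L2_pow k y).
have T : (fun z => (op_pow m P 1 (delta x) z)^* * op_pow m P k (delta y) z * (m z)%:C) =
    (fun z => (moment 1 z x)^* * moment k z y / (m z)%:C).
  apply/funext => z; rewrite !op_pow_delta conj_div_real.
  have mz : (m z)%:C != 0 :> R[i] by rewrite -[0]/(0%:C) (inj_eq (@complexI R)) gt_eqF.
  by field.
split; first by rewrite -T; exact: (inner_csummable m0 l1 l2').
rewrite -T -[RHS]/(inner m _ _) H /moment; congr real_form.
by apply/funext => l; rewrite exprS expr1.
Qed.

(** The square of [Num.sqrt l] is l only for l >= 0, so this rests on the nonnegativity of the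
    spectrum. *)
Lemma form_coef_moment x y : form_coef m P x y = moment 1 x y.
Proof.
have [_ _ Cs _] := lapL.
have ms : measurable_fun setT (@Num.sqrt R).
  by apply: continuous_measurable_fun; exact: sqrt_continuous.
have Ls z : L2 (@Num.sqrt R) (delta z).
  by apply/(L2P _ _ _ ms); exact/Cs/Cc_delta.
rewrite /form_coef (fcalc_inner m0 hP Ls Ls (Ls x) (Ls x) (Ls y) (Ls y)).
apply: (real_form_nneg m0 hP specL L0) => //; try exact: l2_delta.
  exact: measurable_funM.
by move=> l l0; rewrite expr1 -expr2 sqr_sqrtr.
Qed.

Lemma moment1 x y : x != y -> exists2 r : R, moment 1 x y = r%:C &
  (r <= 0) /\ (r < 0 <-> E x y).
Proof.
move=> xy; rewrite -form_coef_moment; have [_ _ _ /(_ _ _ xy)] := lapL.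
move: (form_coef _ _ _ _) => [a b] [].
(* The order of [R[i]] compares only numbers with equal imaginary parts, so [form_coef x y <= 0]
   already forces the coefficient to be real. *)
rewrite lecE ltcE /= => /andP[/eqP <- a0]; rewrite eqxx /=.
by exists a.
Qed.

Lemma joined_byS x y k : joined_by E x y k.+1 <-> exists2 z, E x z & joined_by E z y k.
Proof.
split=> [[p]|[z xz [p [pz lz sz]]]].
  by case: p => [[]|z p []] //= /andP[xz pz] lz [sz]; exists z => //; exists p.
by exists (z :: p); rewrite /= xz sz.
Qed.

Lemma joined_by0 x y : joined_by E x y 0 <-> x = y.
Proof. by split=> [[[|z p] []]|->] //; exists [::]. Qed.

(* In the sum of [momentS] a nonzero term comes from a neighbour z of x at distance
   k of y, and all these terms have the sign of (-1)^(k+1): nothing cancels. *)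
Lemma moment_dist k : forall x y,
  ((forall j, (j <= k)%N -> ~ joined_by E x y j) -> moment k x y = 0) /\
  ((forall j, (j < k)%N -> ~ joined_by E x y j) -> joined_by E x y k ->
    exists2 r : R, moment k x y = r%:C & 0 < (-1) ^+ k * r).
Proof.
elim: k => [|k IH] x y.
  split=> [/(_ 0%N (leqnn 0))|_ /joined_by0 ->].
    rewrite moment0 /Defs.delta; case: eqP => [->|_ _]; last by rewrite mulr0n mul0r.
    by case; exact/joined_by0.
  by exists (m y); rewrite ?expr0 ?mul1r// moment0 /Defs.delta eqxx mulr1n mul1r.
have [sT ->] := momentS k x y.
have nE z : E z x -> forall n, (forall j, (j < n.+1)%N -> ~ joined_by E x y j) ->
    forall j, (j < n)%N -> ~ joined_by E z y j.
  move=> zx n H j jn zy; apply: (H j.+1) => //; apply/joined_byS; exists z => //.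
  by rewrite graphE.1.
(* For the term z = x: the sign condition does not cover [moment 1 x x], so its other factor has to
   vanish. *)
have x0 n : (forall j, (j < n)%N -> ~ joined_by E x y j) -> (k < n)%N -> moment k x y = 0.
  by move=> H kn; apply: (IH x y).1 => j jk; apply: H; exact: leq_ltn_trans kn.
split=> [H|H xy].
  rewrite (_ : (fun z => _) = (fun=> 0)).
    by rewrite /csum rsum0.
  apply/funext => z; have [->|zx] := eqVneq z x.
    by rewrite (x0 k.+1) ?mulr0 ?mul0r// => j jk; apply: H; exact: ltnW.
  have [r -> [r0 rE]] := moment1 zx.
  have [Ezx|nEzx] := boolP (E z x).
    rewrite (IH z y).1 ?mulr0 ?mul0r// => j jk.
    exact: (nE z Ezx k.+1).
  rewrite (_ : r = 0); first by rewrite rmorph0 !mul0r.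
  by apply/eqP; rewrite eq_le r0 leNgt; apply/negP => /rE; exact/negP.
have [z0 Ez0 z0y] := (joined_byS x y k).1 xy.
have term z : exists2 t : R, (moment 1 z x)^* * moment k z y / (m z)%:C = t%:C &
    0 <= (-1) ^+ k.+1 * t /\ (E z x -> joined_by E z y k -> 0 < (-1) ^+ k.+1 * t).
  have [->|zx] := eqVneq z x.
    rewrite (x0 k.+1)// mulr0 mul0r; exists 0 => //; rewrite mulr0; split => //.
    by rewrite graphE.2.
  have [r -> [r0 rE]] := moment1 zx.
  have [Ezx|nEzx] := boolP (E z x); last first.
    rewrite (_ : r = 0); first by exists 0; rewrite ?rmorph0 ?mul0r ?mulr0.
    by apply/eqP; rewrite eq_le r0 leNgt; apply/negP => /rE; exact/negP.
  have [zy|nzy] := pselect (joined_by E z y k).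
    have [s -> s0] := (IH z y).2 (nE z Ezx k H) zy.
    have t0 : 0 < (-1) ^+ k.+1 * (r * s / m z).
      rewrite exprS (_ : _ * _ = (- r) * ((-1) ^+ k * s) / m z); last by field; rewrite gt_eqF.
      by rewrite divr_gt0// mulr_gt0// oppr_gt0; exact/rE.
    exists (r * s / m z); last by split => //; exact: ltW.
    by rewrite conj_real -rmorphM -fmorphV -rmorphM.
  exists 0; last by rewrite mulr0.
  rewrite (IH z y).1 ?mulr0 ?mul0r// => j; rewrite leq_eqVlt => /predU1P[->//|jk].
  exact: (nE z Ezx k H).
have [t tE] := choice (fun z => (let: ex_intro2 t a b := term z in ex_intro _ t (conj a b))).
move: sT; rewrite (_ : (fun z => _) = (fun z => (t z)%:C)); last first.
  by apply/funext => z; case: (tE z).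
move=> [/= st _].
exists (rsum t); first by rewrite /csum /= rsum0.
(* After multiplication by the sign all terms are nonnegative, so the positive one at the neighbour
   z0 bounds the sum from below. *)
rewrite -rsumZ//; apply: lt_le_trans (_ : (-1) ^+ k.+1 * t z0 <= _).
  by have [_ [_]] := tE z0; apply => //; rewrite graphE.1.
have [|s1 e1] := @rsum_single R X z0 (fun z => if z == z0 then (-1) ^+ k.+1 * t z0 else 0).
  by move=> z /negbTE ->.
rewrite eqxx in e1; rewrite -e1; apply: le_rsum => //; first exact: rsummableZ.
by move=> z; case: eqP => [->//|_]; have [_ [+ _]] := tE z.
Qed.

End Moments.

(** * Taylor remainders of exp and cos, and logarithmic asymptotics *)

Section Taylor.
Context (R : realType).
Implicit Types (u : nat -> R -> R).

Definition taylor (c : nat -> R) (n : nat) (s : R) : R :=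
  \sum_(k < n) c k * s ^+ k / k`!%:R.

Lemma is_derive_taylor c n (s : R) :
  is_derive s 1 (taylor c n.+1) (taylor (fun k => c k.+1) n s).
Proof.
elim: n => [|n IH].
  rewrite (_ : taylor c 1 = cst (c 0%N)); last first.
    by apply/funext => x; rewrite /taylor big_ord_recl big_ord0 expr0 fact0 divr1 mulr1 addr0.
  by rewrite /taylor big_ord0; exact: is_derive_cst.
rewrite (_ : taylor c n.+2 = taylor c n.+1 + (c n.+1 / n.+1`!%:R) \*: (id ^+ n.+1)); last first.
  apply/funext => x; rewrite /taylor big_ord_recr /=; congr (_ + _).
  by rewrite /= fctE; rewrite -[_ *: _]/(_ * _) mulrAC.
apply: is_derive_eq; rewrite /taylor big_ord_recr /=; congr (_ + _).
rewrite -[LHS]/(c n.+1 / n.+1`!%:R * ((n.+1%:R * s ^+ n) * 1)) mulr1 factS natrM.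
have n0 : n.+1%:R != 0 :> R by rewrite pnatr_eq0.
have f0 : n`!%:R != 0 :> R by rewrite pnatr_eq0 -lt0n fact_gt0.
by move: (n.+1%:R) (n`!%:R) n0 f0 => a b a0 b0; field; rewrite a0 b0.
Qed.

(** The sequence u lists the successive derivatives of u 0, and the induction on n runs over all
    such sequences, so that it can be applied to the shifted one. By the mean value theorem the
    bound for the derivative gives the bound for the function. *)
Lemma taylor_bound u n (s : R) :
  (forall (k : nat) (x : R), is_derive x 1 (u k) (u k.+1 x)) ->
  (forall k x, 0 <= x -> `|u k x| <= 1) ->
  0 <= s -> `|u 0 s - taylor (fun k => u k 0) n s| <= s ^+ n / n`!%:R.
Proof.
elim: n u s => [|n IH] u s du bu s0.
  by rewrite /taylor big_ord0 subr0 expr0 fact0 divr1 bu.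
have key (e : R) : e = 1 \/ e = -1 ->
    0 <= s ^+ n.+1 / n.+1`!%:R + e * (u 0 s - taylor (fun k => u k 0) n.+1 s).
  (* s^(n+1) / (n+1)! is itself written as a Taylor sum with a single coefficient, so that
     [is_derive_taylor] differentiates both parts. *)
  move=> e1; pose f x := taylor (fun k => (k == n.+1)%:R) n.+2 x +
    e * (u 0 x - taylor (fun k => u k 0) n.+1 x).
  pose df x := taylor (fun k => (k == n)%:R) n.+1 x + e * (u 1 x - taylor (fun k => u k.+1 0) n x).
  have mono k x : taylor (fun j => (j == k)%:R) k.+1 x = x ^+ k / k`!%:R.
    rewrite /taylor big_ord_recr /= eqxx mul1r big1 ?add0r// => j _.
    by rewrite ltn_eqF// !mul0r.
  have dfx (x : R) : is_derive x 1 f (df x).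
    have d1 := is_derive_taylor (fun k => (k == n.+1)%:R) n.+1 x.
    have d2 := is_derive_taylor (fun k => u k 0) n x.
    exact: is_deriveD d1 (is_deriveZ e (is_deriveB (du 0%N x) d2)).
  have cf : {within `[0, s], continuous f}.
    apply: continuous_subspaceT => x; apply: differentiable_continuous.
    by apply/derivable1_diffP; have [] := dfx x.
  have [c] := @MVT_segment R f df 0 s s0 (fun x _ => dfx x) cf.
  rewrite in_itv /= => /andP[c0 _] E.
  have df0 : 0 <= df c.
    rewrite /df mono; have := IH (fun k => u k.+1) c (fun k => du k.+1) (fun k => bu k.+1) c0.
    rewrite ler_norml => /andP[]; case: e1 => ->; lra.
  have f0 : f 0 = 0.
    rewrite /f mono expr0n /= mul0r add0r /taylor big_ord_recl /= expr0 fact0 divr1 mulr1.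
    rewrite big1 ?addr0 ?subrr ?mulr0// => i _.
    by rewrite expr0n /= mulr0 mul0r.
  have : 0 <= f s by move: E; rewrite f0 !subr0 => ->; rewrite mulr_ge0.
  by rewrite /f mono.
have k1 := key 1 (or_introl erefl); have k2 := key (-1) (or_intror erefl).
by rewrite ler_norml; apply/andP; split; lra.
Qed.

(* The k-th derivative of cos. *)
Definition dcos (k : nat) (s : R) : R :=
  if odd k then (-1) ^+ k.+1./2 * sin s else (-1) ^+ k./2 * cos s.

Lemma is_derive_dcos (k : nat) (s : R) : is_derive s 1 (dcos k) (dcos k.+1 s).
Proof.
rewrite /dcos /=; case: (odd k) => /=.
  rewrite (_ : (fun _ => _) = ((-1) ^+ uphalf k) \*: (@sin R))//.
  exact: is_derive_eq.
rewrite (_ : (fun _ => _) = ((-1) ^+ k./2) \*: (@cos R))//.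
apply: is_derive_eq.
by rewrite exprS -[LHS]/(_ * _) mulrN mulN1r mulNr.
Qed.

Lemma dcos_le1 k s : `|dcos k s| <= 1.
Proof.
by rewrite /dcos; case: ifP => _; rewrite normrM normrX normrN1 expr1n mul1r
  ler_norml ?sin_geN1 ?sin_le1 ?cos_geN1 ?cos_le1.
Qed.

(** Ensures that the leading coefficient of exp(-is) at any order, whose real and imaginary parts
    are these two values up to the factorial, does not vanish. *)
Lemma dcos0 k : dcos k 0 ^+ 2 + dcos k.+1 0 ^+ 2 = 1.
Proof.
have E n : ((-1) ^+ n) ^+ 2 = 1 :> R by rewrite exprAC sqrrN expr1n expr1n.
rewrite /dcos /=; case: (odd k) => /=;
  by rewrite sin0 cos0 mulr0 mulr1 expr0n E /= ?addr0 ?add0r.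
Qed.

(* The k-th derivative of s |-> exp(-s). *)
Definition dexp (k : nat) (s : R) : R := (-1) ^+ k * expR (- s).

Lemma is_derive_dexp (k : nat) (s : R) : is_derive s 1 (dexp k) (dexp k.+1 s).
Proof.
have H : is_derive s 1 (fun x : R => expR (- x)) (expR (- s) * -1).
  exact: (is_derive1_comp (is_derive_expR (- s)) (is_deriveNid s 1)).
have := is_deriveZ ((-1) ^+ k) H.
rewrite (_ : _ *: _ = dexp k.+1 s); first exact.
by rewrite -[LHS]/(_ * _) /dexp exprS mulrN1 mulN1r mulrN mulNr.
Qed.

Lemma dexp_le1 k s : 0 <= s -> `|dexp k s| <= 1.
Proof.
move=> s0; rewrite /dexp normrM normrX normrN1 expr1n mul1r ger0_norm ?expR_ge0//.
by rewrite -expR0 ler_expR oppr_le0.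
Qed.

(** For small t the function G lies between c/2 t^d and 2c t^d, so ln (G t) differs from d ln t by
    at most a constant K, while ln t tends to -oo. *)
Lemma log_ratio_cvg (G : R -> R) (c C : R) (d : nat) : 0 < c -> 0 <= C ->
  (forall t, 0 < t -> `|G t - c * t ^+ d| <= C * t ^+ d.+1) ->
  (lne (G t)%:E / (ln t)%:E)%E @[t --> 0^'+] --> (d%:R : R)%:E.
Proof.
move=> c0 C0 H.
pose K : R := `|ln (c / 2)| + `|ln (2 * c)|.
have K0 : 0 <= K by rewrite addr_ge0.
(* t < c / (2 C + 1) gives C t <= c / 2; the 1 keeps the denominator positive when C = 0. *)
have bound : forall t, 0 < t -> t < 1 -> t < c / (2 * C + 1) ->
    0 < G t /\ `|ln (G t) - d%:R * ln t| <= K.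
  move=> t t0 t1 tc; have := H t t0.
  have td : 0 < t ^+ d by rewrite exprn_gt0.
  have Ct : C * t <= c / 2.
    have : t * (2 * C + 1) < c by rewrite -ltr_pdivlMr//; lra.
    by nra.
  have : C * t ^+ d.+1 <= c / 2 * t ^+ d by rewrite exprS mulrA ler_wpM2r// ltW.
  move=> h1 /le_trans/(_ h1); rewrite ler_norml => /andP[lo hi].
  have lo' : c / 2 * t ^+ d <= G t by lra.
  have hi' : G t <= 2 * c * t ^+ d by have := mulr_gt0 c0 td; lra.
  have G0 : 0 < G t by apply: lt_le_trans lo'; rewrite mulr_gt0// divr_gt0.
  split => //.
  have c2 : 0 < c / 2 by rewrite divr_gt0.
  have c2' : 0 < 2 * c by rewrite mulr_gt0.
  have l1 : ln (c / 2) + d%:R * ln t <= ln (G t).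
    rewrite [d%:R * _]mulr_natl -lnXn// -lnM ?posrE// ler_ln ?posrE//.
    by rewrite mulr_gt0.
  have l2 : ln (G t) <= ln (2 * c) + d%:R * ln t.
    rewrite [d%:R * _]mulr_natl -lnXn// -lnM ?posrE// ler_ln ?posrE//.
    by rewrite mulr_gt0.
  have := ler_norm (ln (2 * c)); have := ler_norm (- ln (c / 2)); rewrite normrN.
  have := normr_ge0 (ln (2 * c)); have := normr_ge0 (ln (c / 2)).
  rewrite /K ler_norml => n1 n2 n3 n4; apply/andP; split; lra.
(* Below the last threshold -ln t exceeds K / e + 1, hence K / |ln t| <= e; the added 1 also makes
   ln t negative when K = 0. *)
have small e : 0 < e -> 0 < Num.min (Num.min 1 (c / (2 * C + 1))) (expR (- (K / e + 1))).
  by move=> e0; rewrite !lt_min ltr01 expR_gt0 divr_gt0//; lra.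
have real_cvg : ln (G t) / ln t @[t --> 0^'+] --> (d%:R : R).
  apply/cvgrPdist_le => e e0.
  have s0 := small e e0; near=> t.
  have t0 : 0 < t by near: t; exact: nbhs_right_gt.
  have : t < Num.min (Num.min 1 (c / (2 * C + 1))) (expR (- (K / e + 1))).
    by near: t; exact: nbhs_right_lt.
  rewrite !lt_min => /andP[/andP[t1 t2] t3].
  have [G0 Gb] := bound t t0 t1 t2.
  have lt0 : ln t < - (K / e + 1) by rewrite -[ltRHS]expRK ltr_ln ?posrE// expR_gt0.
  have Ke : 0 <= K / e by rewrite divr_ge0// ltW.
  have ln0 : ln t < 0 by lra.
  have lnN0 : ln t != 0 by rewrite lt_eqF.
  rewrite -[d%:R](mulfK lnN0) -mulrBl normrM normfV distrC.
  rewrite ler_pdivrMr ?normr_gt0 ?lt_eqF//; apply: le_trans Gb _.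
  rewrite (ltr0_norm ln0).
  have : K / e <= - ln t by lra.
  by rewrite ler_pdivrMr// (mulrC e).
apply: cvg_trans; last first.
  apply: (@cvg_EFin R R _ _ (fun t => (ln (G t) / ln t)%:E) d%:R _ real_cvg).
  by near=> t.
(* Near 0 both 0 < G t and ln t < 0 hold, so the extended logarithm and quotient are the real
   ones. *)
apply: near_eq_cvg; have s0 := small 1 ltr01; near=> t.
have t0 : 0 < t by near: t; exact: nbhs_right_gt.
have : t < Num.min (Num.min 1 (c / (2 * C + 1))) (expR (- (K / 1 + 1))).
  by near: t; exact: nbhs_right_lt.
rewrite !lt_min => /andP[/andP[t1 t2] _].
have [G0 _] := bound t t0 t1 t2.
rewrite lne_EFin// inver lt_eqF ?ln_lt0 ?t0//.
Unshelve. all: by end_near. Qed.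

End Taylor.

(** * Small-time asymptotics of the two kernels *)

Section Asymptotics.
Context (R : realType) (X : countType) (m : X -> R) (m0 : forall x, 0 < m x).
Context (P : set R -> (X -> R[i]) -> X -> R[i]).
Context (E : rel X) (graphE : combinatorial_graph E).
Context (L : operator R X) (specL : spectral_resolution m P L)
  (lapL : laplacian_on_graph m P E L)
  (Cc_powL : forall n : nat, @Cc R X `<=` opdom (op_pow m P n)).
Local Notation sform := (real_form m P).
Local Notation L1 := (L1 m P).
Local Notation L2 := (L2 m P).
Local Notation delta := (delta R).
Local Notation moment := (moment m P).
Let hP : projection_valued_measure m P := specL.1.
Let L0 : nonneg_operator m L.
Proof. by case: lapL. Qed.

Lemma L1_pow n x : L1 (fun l => l ^+ n) (delta x).
Proof. exact/(L2_L1 m0 hP)/L2_pow. Qed.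

Lemma real_form_poly (c : nat -> R) n x y :
  L1 (fun l => \sum_(k < n) c k * l ^+ k) (delta x) /\
  L1 (fun l => \sum_(k < n) c k * l ^+ k) (delta y) /\
  sform (fun l => \sum_(k < n) c k * l ^+ k) (delta x) (delta y) =
  \sum_(k < n) (c k)%:C * moment k x y.
Proof.
elim: n => [|n [IHx [IHy IH]]].
  rewrite big_ord0 (_ : (fun _ => _) = (fun=> 0)); last first.
    by apply/funext => l; rewrite big_ord0.
  split; first exact: (L1_cst m0 hP 0 (l2_delta m0 x)).
  split; first exact: (L1_cst m0 hP 0 (l2_delta m0 y)).
  rewrite (real_form_simple m0 hP (simple_nil P) (l2_delta m0 x) (l2_delta m0 y)).
  exact: inner0r.
rewrite (_ : (fun _ => _) = (fun l => c n * l ^+ n + \sum_(k < n) c k * l ^+ k)); last first.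
  by apply/funext => l; rewrite big_ord_recr /= addrC.
split; first exact: L1_lin (L1_pow n x) IHx.
split; first exact: L1_lin (L1_pow n y) IHy.
by rewrite (real_form_lin m0 hP (c n) (L1_pow n x) (L1_pow n y) IHx IHy) IH big_ord_recr /= addrC.
Qed.

(** The estimates at hand hold for l >= 0 only; cutting off turns them into bounds on the whole
    line, as integrability lemmas require. *)
Lemma indic_ge0 (phi psi : R -> R) : (forall l, 0 <= l -> `|phi l| <= psi l) ->
  (forall l, 0 <= psi l) -> forall l, `|phi l * \1_(`[0, +oo[%classic) l| <= psi l.
Proof.
move=> H psi0 l; rewrite indicE; have [/set_mem|_] := boolP (l \in _).
  by rewrite /= in_itv /= andbT mulr1; exact: H.
by rewrite mulr0 normr0.
Qed.

Lemma indic_ge0E (phi : R -> R) l : 0 <= l -> phi l * \1_(`[0, +oo[%classic) l = phi l.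
Proof. by move=> l0; rewrite indicE mem_set ?mulr1//= in_itv /= andbT. Qed.

(** One constant C serves all t and [phi], because on l >= 0 the remainder is at most t^(d+1) times
    the fixed function l^(d+1). *)
Lemma real_form_taylor (u : nat -> R -> R) d x y :
  (forall (k : nat) (s : R), is_derive s 1 (u k) (u k.+1 s)) ->
  (forall k s, 0 <= s -> `|u k s| <= 1) ->
  (forall k, (k < d)%N -> moment k x y = 0) ->
  exists2 C : R, 0 <= C & forall t (phi : R -> R), 0 < t -> measurable_fun setT phi ->
    (forall l, 0 <= l -> phi l = u 0%N (t * l)) ->
    cmod (sform phi (delta x) (delta y) - (u d 0 / d`!%:R * t ^+ d)%:C * moment d x y)
      <= C * t ^+ d.+1.
Proof.
move=> du bu M0.
pose psi (l : R) := `|l ^+ d.+1|.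
have Lpsi z : L1 psi (delta z) by exact/(L1_norm m0 hP)/L1_pow.
(* The bound of [real_form_bound] with the factor t^(d+1) taken out; the absolute value makes it
   visibly nonnegative. *)
pose C := `|\sum_(k < 4) spectral_int m P psi (fun z => delta y z + 'i%C ^+ k * delta x z)|.
exists C; first exact: normr_ge0.
move=> t phi t0 mphi phiE.
pose c k := u k 0 * t ^+ k / k`!%:R.
pose p l := \sum_(k < d.+1) c k * l ^+ k.
have [Lpx [Lpy pE]] := real_form_poly c d.+1 x y.
have mp := L1_meas Lpx.
have pT l : p l = taylor (fun k => u k 0) d.+1 (t * l).
  by rewrite /p /taylor; apply: eq_bigr => k _; rewrite /c exprMn; ring.
pose rho l := (phi l - p l) * \1_(`[0, +oo[%classic) l.
have mrho : measurable_fun setT rho.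
  by apply: measurable_funM; [exact: measurable_funB|exact: measurable_indic].
have rho_le l : `|rho l| <= t ^+ d.+1 * psi l.
  apply: (indic_ge0 (phi := fun l => phi l - p l) (psi := fun l => t ^+ d.+1 * psi l)).
    move=> {}l l0; rewrite phiE// pT.
    have tl0 : 0 <= t * l by rewrite mulr_ge0// ltW.
    apply: le_trans (taylor_bound _ du bu tl0) _.
    rewrite /psi -[t ^+ _]ger0_norm ?exprn_ge0 ?(ltW t0)// -normrM -exprMn.
    rewrite ger0_norm ?exprn_ge0// ler_pdivrMr ?ltr0n ?fact_gt0//.
    by rewrite ler_peMr ?exprn_ge0// ler1n fact_gt0.
  by move=> ?; apply: mulr_ge0; [exact/exprn_ge0/ltW|exact: normr_ge0].
have Ltpsi z : L1 (fun l => t ^+ d.+1 * psi l) (delta z).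
  exact: (L1_scale m0 hP _ (Lpsi z)).
have Lrho z : L1 rho (delta z) by exact: (L1_le m0 hP mrho rho_le (Ltpsi z)).
have -> : sform phi (delta x) (delta y) = sform (fun l => 1 * p l + rho l) (delta x) (delta y).
  apply: (real_form_nneg m0 hP specL L0) => //; try exact: l2_delta.
    by apply: measurable_funD => //; exact: measurable_funM.
  by move=> l l0; rewrite /rho (indic_ge0E (fun l => phi l - p l))// mul1r addrC subrK.
rewrite (real_form_lin m0 hP 1 Lpx Lpy (Lrho x) (Lrho y)) rmorph1 mul1r pE.
rewrite big_ord_recr /= big1 ?add0r; last first.
  by move=> k _; rewrite M0// mulr0.
rewrite (_ : u d 0 / _ * _ = c d); last by rewrite /c; ring.
rewrite addrAC subrr add0r.
apply: le_trans (real_form_bound m0 hP mrho rho_le (Ltpsi x) (Ltpsi y)) _.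
rewrite [leRHS]mulrC /C.
under eq_bigr => k _ do rewrite (spectral_int_scale m0 hP _ (L1_add m0 hP ('i%C ^+ k) (Lpsi y) (Lpsi x))).
by rewrite -mulr_sumr; apply: ler_wpM2l; [exact/exprn_ge0/ltW|exact: ler_norm].
Qed.

Lemma graph_dist_spec x y : connected_graph E ->
  joined_by E x y (graph_dist E x y) /\
  forall j, (j < graph_dist E x y)%N -> ~ joined_by E x y j.
Proof.
move=> /(_ x y) ex; rewrite /graph_dist; case: eqP => [->|_].
  by split => //; exact/joined_by0.
have [n [nj nmin]] : exists n, joined_by E x y n /\ forall k, joined_by E x y k -> (n <= k)%N.
  have exb : exists n, `[< joined_by E x y n >] by have [n ?] := ex; exists n; exact/asboolP.
  exists (ex_minn exb); case: ex_minnP => n /asboolP nj nmin; split => // k /asboolP.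
  exact: nmin.
set d := xget _ _.
have [dj dmin] : joined_by E x y d /\ forall k, joined_by E x y k -> (d <= k)%N.
  exact: (@xgetPex _ 0%N [set n | joined_by E x y n /\ forall k, joined_by E x y k -> (n <= k)%N]
    (ex_intro _ n (conj nj nmin))).
by split => // j jd /dmin; rewrite leqNgt jd.
Qed.

Lemma log_ratio_moment (F : R -> R[i]) (w : R[i]) x y (C : R) :
  connected_graph E -> w != 0 -> 0 <= C ->
  (forall t, 0 < t -> cmod (F t - (t ^+ graph_dist E x y)%:C * w) <= C * t ^+ (graph_dist E x y).+1) ->
  (lne (cmod (F t))%:E / (ln t)%:E)%E @[t --> 0^'+] --> ((graph_dist E x y)%:R : R)%:E.
Proof.
move=> connE w0 C0 H; apply: (@log_ratio_cvg _ _ (cmod w) C) => //.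
  by rewrite lt_neqAle cmod_ge0 andbT eq_sym; apply: contra w0 => /eqP/cmod0_eq0 ->.
move=> t t0; apply: le_trans (H t t0).
set d := graph_dist _ _ _.
have -> : cmod w * t ^+ d = cmod ((t ^+ d)%:C * w).
  by rewrite cmodM cmodr ger0_norm ?exprn_ge0 ?(ltW t0)// mulrC.
set W := _ * w.
have D1 := cmodD (F t - W) W; rewrite subrK in D1.
have D2 := cmodD (- (F t - W)) (F t); rewrite cmodN opprB subrK in D2.
by rewrite ler_norml; apply/andP; split; lra.
Qed.

Lemma dist_moment x y : connected_graph E ->
  exists2 r : R, moment (graph_dist E x y) x y = r%:C & r != 0.
Proof.
move=> connE; have [dj dmin] := graph_dist_spec x y connE.
have [r rE r0] := (moment_dist m0 graphE specL lapL Cc_powL _ x y).2 dmin dj.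
by exists r => //; apply: contraTneq r0 => ->; rewrite mulr0 ltxx.
Qed.

Lemma moment_lt_dist x y k : connected_graph E ->
  (k < graph_dist E x y)%N -> moment k x y = 0.
Proof.
move=> connE kd; have [_ dmin] := graph_dist_spec x y connE.
apply: (moment_dist m0 graphE specL lapL Cc_powL k x y).1 => j jk.
exact/dmin/(leq_ltn_trans jk).
Qed.

Lemma heat_limit x y : connected_graph E ->
  (lne (cmod (inner m (delta x) (heat m P t (delta y))))%:E
     / (ln t)%:E)%E @[t --> 0^'+] --> ((graph_dist E x y)%:R : R)%:E.
Proof.
move=> connE; set d := graph_dist _ _ _.
have [r rE r0] := dist_moment x y connE.
have [C C0 H] := real_form_taylor (@is_derive_dexp R) (@dexp_le1 R)
  (fun k => @moment_lt_dist x y k connE).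
have df : d`!%:R != 0 :> R by rewrite pnatr_eq0 -lt0n fact_gt0.
apply: (@log_ratio_moment _ (dexp d 0 / d`!%:R * r)%:C _ _ C) => //.
  have c0 : dexp d 0 / d`!%:R * r != 0.
    by rewrite !mulf_neq0 ?invr_eq0// ?signr_eq0// gt_eqF ?expR_gt0.
  by apply: contraNneq c0 => c0; apply/eqP; exact: (@complexI R _ 0 c0).
move=> t t0; pose phi (l : R) := expR (- (t * l)).
have mphi : measurable_fun setT phi.
  apply: measurableT_comp; first exact: measurable_expR.
  by apply: measurableT_comp => //; exact: measurable_funM.
have L2phi f : l2 m f -> L2 phi f.
  (* exp(-tl) is unbounded for l < 0; its cut-off is bounded by 1 and has the same integrals. *)
  move=> lf; pose psi l := phi l * \1_(`[0, +oo[%classic) l.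
  have mpsi : measurable_fun setT psi.
    by apply: measurable_funM => //; exact: measurable_indic.
  apply: (L2_nneg m0 hP specL L0 mphi (psi := psi)).
    by move=> l l0; rewrite /psi indic_ge0E.
  apply: (L2_bounded m0 hP (c := 1) lf mpsi).
  apply: (indic_ge0 (phi := phi) (psi := fun=> 1)) => [l l0|_]; last exact: ler01.
  by rewrite ger0_norm ?expR_ge0// -expR0 ler_expR oppr_le0 mulr_ge0// ltW.
have [_ HI _] := fcalc_spec m0 hP mphi (fun z => L2phi _ (l2_delta m0 z)) (L2phi _ (l2_delta m0 y)).
rewrite /heat HI; last exact/(L2_L1 m0 hP)/L2phi/l2_delta.
apply: le_trans (H t phi t0 mphi _); last by move=> l _; rewrite /dexp expr0 mul1r.
by rewrite rE -!rmorphM /= [_ ^+ _ * _]mulrA [_ ^+ _ * _]mulrC.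
Qed.

(** The real and imaginary parts cos(tl) and -sin(tl) are [dcos 0] and [dcos 1] at tl, so the same
    expansion applies to [dcos] and to its shift. Together the leading terms have the coefficient
    (-i)^d / d!, nonzero by [dcos0]. *)
Lemma schroedinger_limit x y : connected_graph E ->
  (lne (cmod (inner m (delta x) (schroedinger m P t (delta y))))%:E
     / (ln t)%:E)%E @[t --> 0^'+] --> ((graph_dist E x y)%:R : R)%:E.
Proof.
move=> connE; set d := graph_dist _ _ _.
have [r rE r0] := dist_moment x y connE.
have M0 k := @moment_lt_dist x y k connE.
have [C C0 H] := real_form_taylor (@is_derive_dcos R) (fun k s _ => dcos_le1 k s) M0.
have [C' C'0 H'] := real_form_taylor (u := fun k => dcos k.+1) (fun k => @is_derive_dcos R k.+1)
  (fun k s _ => dcos_le1 k.+1 s) M0.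
have df : d`!%:R != 0 :> R by rewrite pnatr_eq0 -lt0n fact_gt0.
pose w : R[i] := ((dcos d 0)%:C + 'i%C * (dcos d.+1 0)%:C) * (r / d`!%:R)%:C.
apply: (@log_ratio_moment _ w _ _ (C + C')) => //; last 2 first.
- exact: addr_ge0.
- move=> t t0; pose a (l : R) := cos (t * l); pose b (l : R) := - sin (t * l).
  have mt : measurable_fun setT (fun l : R => t * l) by exact: measurable_funM.
  have ma : measurable_fun setT a.
    by apply: measurableT_comp mt; apply: continuous_measurable_fun; exact: continuous_cos.
  have mb : measurable_fun setT b.
    apply: measurableT_comp => //; apply: measurableT_comp mt.
    apply: continuous_measurable_fun; exact: continuous_sin.
  have La f : l2 m f -> L2 a f.
    move=> lf; apply: (L2_bounded m0 hP (c := 1) lf ma) => l.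
    by rewrite ler_norml cos_geN1 cos_le1.
  have Lb f : l2 m f -> L2 b f.
    move=> lf; apply: (L2_bounded m0 hP (c := 1) lf mb) => l.
    by rewrite normrN ler_norml sin_geN1 sin_le1.
  rewrite (fcalc_complex m0 hP x La Lb (l2_delta m0 y)).
  have Ha := H t a t0 ma _; have Hb := H' t b t0 mb _.
  rewrite (_ : _ - _ = (sform a (delta x) (delta y) - (dcos d 0 / d`!%:R * t ^+ d)%:C * moment d x y)
    + 'i%C * (sform b (delta x) (delta y) - (dcos d.+1 0 / d`!%:R * t ^+ d)%:C * moment d x y)); last first.
    rewrite rE /w !rmorphM /= fmorphV; ring.
  apply: le_trans (cmodD _ _) _; rewrite mulrDl; apply: lerD.
    by apply: Ha => l _; rewrite /dcos /= expr0 mul1r.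
  rewrite cmodM -[X in cmod X * _]expr1 cmod_iX mul1r.
  by apply: Hb => l _; rewrite /dcos /= expr1 mulN1r.
apply/eqP => w0; have := congr1 (@cmod R) w0; rewrite cmod0 /w cmodM cmodr.
have N (p q : R) : cmod (p%:C + 'i%C * q%:C) = Num.sqrt (p ^+ 2 + q ^+ 2).
  by rewrite cmodE; congr Num.sqrt; rewrite /=; ring.
rewrite N dcos0 sqrtr1 mul1r => /eqP; rewrite normr_eq0; apply/negP.
by rewrite mulf_neq0 ?invr_eq0.
Qed.

End Asymptotics.

Theorem corollary2p3 (R : realType) (X : countType) (m : X -> R)
    (m_gt0 : forall x, 0 < m x)
    (E : rel X) (graphE : combinatorial_graph E) (connE : connected_graph E)
    (L : operator R X) (P : set R -> (X -> R[i]) -> X -> R[i])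
    (specL : spectral_resolution m P L)
    (lapL : laplacian_on_graph m P E L)
    (Cc_powL : forall n : nat, @Cc R X `<=` opdom (op_pow m P n))
    (x y : X) :
  (lne (cmod (inner m (delta R x) (heat m P t (delta R y))))%:E
     / (ln t)%:E)%E @[t --> 0^'+] --> ((graph_dist E x y)%:R : R)%:E /\
  (lne (cmod (inner m (delta R x) (schroedinger m P t (delta R y))))%:E
     / (ln t)%:E)%E @[t --> 0^'+] --> ((graph_dist E x y)%:R : R)%:E.
Proof.
split; first exact: (heat_limit m_gt0 graphE specL lapL Cc_powL).
exact: (schroedinger_limit m_gt0 graphE specL lapL Cc_powL).
Qed.
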